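(* Let $k$ be a graded-commutative superring and let $A=A_0\oplus A_1$ be an associative superalgebra with unit over $k$. Let $p,q$ be natural numbers, not both zero, and let $\mathcal{M}_{p,q}(A)$ be the $k$-superalgebra of square supermatrices of type $(p|q)\times(p|q)$ over $A$. Then the supertrace map $$\operatorname{str}:\mathcal{M}_{p,q}(A)\to A$$ can be extended to a morphism of cyclic bicomplexes (of $k$-modules) $$\operatorname{Str}:CC_{*,*}\left(\mathcal{M}_{p,q}(A)\right)\to CC_{*,*}(A),$$ i.e. a family of maps $CC_{i,j}(\mathcal{M}_{p,q}(A))\to CC_{i,j}(A)$ commuting with all horizontal and vertical differentials and equal to $\operatorname{str}$ in row $j=0$, such that $\operatorname{Str}$ induces an isomorphism in cyclic homology $$HC_n\left(\mathcal{M}_{p,q}(A)\right)\xrightarrow{\ \cong\ }HC_n(A)\qquad\text{for all } n\ge 0.$$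
   Context: **Superalgebras.** ''Super'' means $\mathbb{Z}_2$-graded. The parity of a homogeneous element $a$ is denoted $|a|\in\mathbb{Z}_2$. All tensor products are over $k$ and are taken in the graded sense. The grading of $k$ may be trivial, in which case $k$ is an ordinary commutative ring concentrated in degree $0$. In a $k$-superalgebra $A$ one has $\lambda a=(-1)^{|\lambda||a|}a\lambda$ for homogeneous $\lambda\in k$, $a\in A$. Formulas given on homogeneous elements are extended additively. **Supermatrices.** $\mathcal{M}_{p,q}(A)$ is the set of $(p+q)\times(p+q)$ matrices with entries in $A$, written in block form $$M=\begin{pmatrix}M_{11}&M_{12}\\ M_{21}&M_{22}\end{pmatrix}$$ with $M_{11}$ of size $p\times p$, $M_{12}$ of size $p\times q$, $M_{21}$ of size $q\times p$, $M_{22}$ of size $q\times q$. $M$ is even if $M_{11},M_{22}$ have even entries and $M_{12},M_{21}$ have odd entries. It is odd if $M_{11},M_{22}$ have odd entries and $M_{12},M_{21}$ have even entries. The product is usual matrix multiplication. A homogeneous $\lambda\in k$ acts on the left (respectively right) as left (respectively right) multiplication by the block-diagonal matrix $\operatorname{diag}(\lambda I_p,(-1)^{|\lambda|}\lambda I_q)$. This is entrywise multiplication when $k$ is trivially graded. With this structure $\mathcal{M}_{p,q}(A)$ is a unital $k$-superalgebra. **Supertrace.** For homogeneous $M$, $\operatorname{str}M=\operatorname{tr}M_{11}+(-1)^{1+|M|}\operatorname{tr}M_{22}$, where $\operatorname{tr}$ is the sum of the diagonal entries. It is extended additively to all of $\mathcal{M}_{p,q}(A)$. **Cyclic bicomplex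 and cyclic homology of a unital superalgebra $R$ over $k$.** Let $C_n(R)=R^{\otimes(n+1)}$ for $n\ge 0$. For $n\ge1$ and $0\le i\le n$ define $d_i:C_n(R)\to C_{n-1}(R)$ on homogeneous elements by $$d_i(a_0\otimes\dots\otimes a_n)=\begin{cases}a_0\otimes\dots\otimes a_ia_{i+1}\otimes\dots\otimes a_n,&0\le i<n,\\(-1)^{|a_n|(|a_0|+\dots+|a_{n-1}|)}a_na_0\otimes a_1\otimes\dots\otimes a_{n-1},&i=n.\end{cases}$$ Put $b_n=\sum_{i=0}^n(-1)^id_i$ and $b'_n=\sum_{i=0}^{n-1}(-1)^id_i$. Define $t_n:C_n(R)\to C_n(R)$ by $$t_n(a_0\otimes\dots\otimes a_n)=(-1)^{n+|a_n|(|a_0|+\dots+|a_{n-1}|)}a_n\otimes a_0\otimes\dots\otimes a_{n-1},$$ and $N_n=1+t_n+t_n^2+\dots+t_n^n$. The cyclic bicomplex $CC_{*,*}(R)$ has $CC_{i,j}(R)=C_j(R)$ for $i,j\ge0$ ($i$ is the column, $j$ the row). The vertical differential $CC_{i,j}\to CC_{i,j-1}$ is $b_j$ if $i$ is even and $b'_j$ if $i$ is odd. The horizontal differential $CC_{i,j}\to CC_{i-1,j}$ ($i\ge1$) is $1-t_j$ if $i$ is odd and $N_j$ if $i$ is even. The squares commute, and the total complex is formed with the usual signs (e.g. replacing $b'$ by $-b'$). $HC_n(R)$ is the $n$-th homology of the total complex, $\operatorname{Tot}_n=\bigoplus_{i+j=n}CC_{i,j}(R)$. *)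

(* Defs.v *)
From HB Require Import structures.
From mathcomp Require Import all_boot.
From mathcomp Require Import nmodule ssralg ssrint matrix ring_quotient generic_quotient.
From mathcomp Require Import zify.
From mathcomp.classical Require Import boolp.
From mathcomp.multinomials Require Import freeg.

Set Implicit Arguments.
Unset Strict Implicit.
Unset Printing Implicit Defensive.

Import GRing.Theory.
Local Open Scope ring_scope.
Local Open Scope quotient_scope.

(* A Z/2-grading is given by its two projections; parities are booleans, added
   with (+), true being odd. *)
HB.mixin Record isSuperZmod V of GRing.Zmodule V := {
  hcomp : bool -> V -> V;
  hcompD : forall e, {morph hcomp e : x y / x + y};
  hcompI : forall e f x, hcomp e (hcomp f x) = if e == f then hcomp f x else 0;
  hcomp_sum : forall x, hcomp false x + hcomp true x = x
}.
#[short(type="superZmodType")]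
HB.structure Definition SuperZmod := {V of isSuperZmod V & GRing.Zmodule V}.

Definition homog (V : superZmodType) (e : bool) (x : V) : Prop := hcomp e x = x.

HB.mixin Record SuperZmod_isSuperRing R of SuperZmod R & GRing.PzRing R := {
  homog1 : homog false (1 : R);
  homogM : forall e f (x y : R), homog e x -> homog f y -> homog (e (+) f) (x * y)
}.
#[short(type="superRingType")]
HB.structure Definition SuperRing :=
  {R of SuperZmod_isSuperRing R & SuperZmod R & GRing.PzRing R}.

HB.mixin Record SuperRing_isGradedCom R of SuperRing R := {
  mulrSC : forall e f (x y : R), homog e x -> homog f y ->
    x * y = (-1) ^+ (e && f) * (y * x)
}.
#[short(type="superComRingType")]
HB.structure Definition SuperComRing :=
  {R of SuperRing_isGradedCom R & SuperRing R}.

(* The sign rule lscaleSC makes either action determine the other; both are kept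
   as data so that each can be given by its own formula. *)
HB.mixin Record SuperRing_isSuperAlg (k : superComRingType) A of SuperRing A := {
  lscale : k -> A -> A;
  rscale : A -> k -> A;
  lscaleA : forall l m (a : A), lscale l (lscale m a) = lscale (l * m) a;
  lscale1 : forall a : A, lscale 1 a = a;
  lscaleDr : forall l, {morph lscale l : a b / a + b};
  lscaleDl : forall a, {morph lscale^~ a : l m / l + m};
  rscaleDl : forall l, {morph rscale^~ l : a b / a + b};
  rscaleDr : forall a, {morph rscale a : l m / l + m};
  homogZ : forall e f (l : k) (a : A),
    homog e l -> homog f a -> homog (e (+) f) (lscale l a);
  lscaleSC : forall e f (l : k) (a : A), homog e l -> homog f a ->
    lscale l a = (-1) ^+ (e && f) * rscale a l;
  lscaleAl : forall (l : k) (a b : A), lscale l (a * b) = lscale l a * b;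
  rscaleMl : forall (l : k) (a b : A), rscale a l * b = a * lscale l b;
  rscaleAr : forall (l : k) (a b : A), rscale (a * b) l = a * rscale b l
}.
#[short(type="superAlgType")]
HB.structure Definition SuperAlg (k : superComRingType) :=
  {A of SuperRing_isSuperAlg k A & SuperRing A}.

Section SuperZmodTheory.
Variable V : superZmodType.
Implicit Types (x y : V) (e f : bool).

Fact hcomp_nmod_morphism e : nmod_morphism (@hcomp V e).
Proof.
split; last exact: hcompD.
by apply: (addIr (hcomp e 0)); rewrite -hcompD !add0r.
Qed.
HB.instance Definition _ e :=
  GRing.isNmodMorphism.Build V V (@hcomp V e) (hcomp_nmod_morphism e).

Lemma homog_hcomp e x : homog e (hcomp e x).
Proof. by rewrite /homog hcompI eqxx. Qed.

Lemma hcomp_homog e f x : homog f x -> hcomp e x = if e == f then x else 0.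
Proof. by rewrite /homog => fx; rewrite -{1}fx hcompI fx. Qed.

Lemma sum_hcomp x : \sum_e hcomp e x = x.
Proof. by rewrite -[RHS]hcomp_sum big_bool /= [RHS]addrC. Qed.

Lemma homogD e x y : homog e x -> homog e y -> homog e (x + y).
Proof. by move=> hx hy; rewrite /homog hcompD hx hy. Qed.
Lemma homogN e x : homog e x -> homog e (- x).
Proof. by move=> hx; rewrite /homog raddfN /= hx. Qed.
Lemma homog0 e : homog e (0 : V).
Proof. exact: raddf0. Qed.
End SuperZmodTheory.

Section SuperAlgTheory.
Variables (k : superComRingType) (A : superAlgType k).
Implicit Types (a b : A) (l m : k) (e f : bool).

Lemma lscaleN1 a : lscale (-1 : k) a = - a.
Proof.
have l0 : lscale (0 : k) a = 0.
  by apply: (addIr (lscale (0 : k) a)); rewrite -lscaleDl !add0r.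
by apply/eqP; rewrite -addr_eq0 -{2}(lscale1 (k := k) a) -lscaleDl addNr l0.
Qed.

Lemma rscaleSC e f l a : homog e l -> homog f a ->
  rscale a l = (-1) ^+ (e && f) * lscale l a.
Proof.
move=> hl ha; rewrite (lscaleSC _ _ _ _ hl ha) mulrA -exprD.
by case: (e && f); rewrite ?mul1r // -signr_odd mul1r.
Qed.

Lemma homogR e f l a : homog e l -> homog f a -> homog (e (+) f) (rscale a l).
Proof.
move=> hl ha; rewrite (rscaleSC hl ha); case: (e && f).
  by rewrite mulN1r; apply/homogN/homogZ.
by rewrite mul1r; apply: homogZ.
Qed.

Lemma lrscale l m a : lscale l (rscale a m) = rscale (lscale l a) m.
Proof.
have H b : rscale b m = b * rscale 1 m by rewrite -rscaleAr mulr1.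
by rewrite H lscaleAl -H.
Qed.

End SuperAlgTheory.

Definition upd (I : finType) (T : Type) (a : {ffun I -> T}) (i : I) (x : T) :
  {ffun I -> T} := [ffun j => if j == i then x else a j].

Section UpdTheory.
Variables (I : finType) (T : Type).
Implicit Types (a : {ffun I -> T}) (i j : I).
Lemma upd_id a i : upd a i (a i) = a.
Proof. by apply/ffunP=> j; rewrite ffunE; case: eqP => // ->. Qed.
Lemma upd_upd a i x y : upd (upd a i x) i y = upd a i y.
Proof. by apply/ffunP=> j; rewrite !ffunE; case: eqP. Qed.
Lemma updC a i j x y : i != j -> upd (upd a i x) j y = upd (upd a j y) i x.
Proof.
move=> ij; apply/ffunP=> m; rewrite !ffunE.
by case: eqP => // ->; rewrite eq_sym (negbTE ij).
Qed.
Lemma upd_same a i x : upd a i x i = x.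
Proof. by rewrite ffunE eqxx. Qed.
Lemma upd_diff a i j x : j != i -> upd a i x j = a j.
Proof. by move=> ij; rewrite ffunE (negbTE ij). Qed.
End UpdTheory.

Section TensorPower.
Variables (k : superComRingType) (R : superAlgType k).

Local Notation tup n := {ffun 'I_n.+1 -> R}.
Local Notation freeT n := {freeg (tup n) / int}.

(* The (n+1)-fold tensor power of R over k is the free abelian group on tuples
   modulo additivity in each entry and the balancing relations
   a_i l (x) a_(i+1) = a_i (x) l a_(i+1); k acts through the outermost factors. *)
Inductive tens_rel (n : nat) : freeT n -> Prop :=
| tens_rel0 : tens_rel 0
| tens_relB u v : tens_rel u -> tens_rel v -> tens_rel (u - v)
| tens_relD (a : tup n) i x y :
    tens_rel (<< upd a i (x + y) >> - << upd a i x >> - << upd a i y >>)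
| tens_relZ (a : tup n) (i j : 'I_n.+1) (l : k) : j = i.+1 :> nat ->
    tens_rel (<< upd a i (rscale (a i) l) >> - << upd a j (lscale l (a j)) >>).

Definition tens_relb n : {pred freeT n} := fun u => `[< tens_rel u >].

Fact tens_relb_closed n : zmod_closed (@tens_relb n).
Proof.
split=> [|u v /asboolP ru /asboolP rv]; apply/asboolP.
- exact: tens_rel0.
- exact: tens_relB.
Qed.
HB.instance Definition _ n :=
  GRing.isZmodClosed.Build (freeT n) (@tens_relb n) (@tens_relb_closed n).

Definition chains (n : nat) : Type := Quotient.quot (@tens_relb n).
HB.instance Definition _ n := GRing.Zmodule.on (chains n).

Definition tpure n (a : tup n) : chains n := \pi_(Quotient.quot (@tens_relb n)) << a >>.

Definition chain0 (x : R) : chains 0 := tpure [ffun=> x].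

Definition multiadd n (W : zmodType) (f : tup n -> W) :=
  forall a i x y, f (upd a i (x + y)) = f (upd a i x) + f (upd a i y).

Definition multilin n (W : zmodType) (f : tup n -> W) :=
  multiadd f /\ forall (a : tup n) (i j : 'I_n.+1) (l : k), j = i.+1 :> nat ->
    f (upd a i (rscale (a i) l)) = f (upd a j (lscale l (a j))).

Definition tlift n (W : zmodType) (f : tup n -> W) (x : chains n) : W :=
  fglift (f : tup n -> zmodule W) (repr (x : Quotient.quot (@tens_relb n))).

Lemma fgliftB n (W : zmodType) (f : tup n -> W) :
  zmod_morphism (fglift (f : tup n -> zmodule W)).
Proof. exact: lift_is_additive. Qed.

Lemma fgliftU n (W : zmodType) (f : tup n -> W) a :
  fglift (f : tup n -> zmodule W) << a >> = f a.
Proof. by rewrite liftU scale1r. Qed.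

Lemma fglift_rel n (W : zmodType) (f : tup n -> W) u : multilin f ->
  tens_rel u -> fglift (f : tup n -> zmodule W) u = 0.
Proof.
move=> [fD fZ]; elim=> {u} [|u v _ iu _ iv|a i x y|a i j l ij].
- by rewrite -(subrr 0) fgliftB subrr.
- by rewrite fgliftB iu iv subrr.
- by rewrite !fgliftB !fgliftU fD addrAC addrK subrr.
- by rewrite !fgliftB !fgliftU (fZ _ _ _ _ ij) subrr.
Qed.

Lemma tlift_pi n (W : zmodType) (f : tup n -> W) u : multilin f ->
  tlift f (\pi_(Quotient.quot (@tens_relb n)) u) = fglift (f : tup n -> zmodule W) u.
Proof.
move=> fl; apply/eqP; rewrite -subr_eq0 -fgliftB; apply/eqP/fglift_rel => //.
by apply/asboolP; rewrite -[`[< _ >]]/(_ \in @tens_relb n) Quotient.idealrBE reprK.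
Qed.

Lemma tliftE n (W : zmodType) (f : tup n -> W) a : multilin f ->
  tlift f (tpure a) = f a.
Proof. by move=> fl; rewrite tlift_pi // fgliftU. Qed.

Lemma tliftB n (W : zmodType) (f : tup n -> W) : multilin f ->
  zmod_morphism (tlift f).
Proof.
move=> fl x y; rewrite -[x]reprK -[y]reprK -[_ - _](raddfB \pi) !tlift_pi //.
exact: fgliftB.
Qed.

Lemma tpure_multilin n : multilin (@tpure n).
Proof.
split=> [a i x y|a i j l ij]; apply/eqP.
  rewrite -subr_eq0 opprD addrA /tpure -!(raddfB \pi) -(raddf0 \pi).
  by rewrite -Quotient.idealrBE subr0; apply/asboolP/tens_relD.
rewrite -subr_eq0 /tpure -!(raddfB \pi) -(raddf0 \pi).
by rewrite -Quotient.idealrBE subr0; apply/asboolP/tens_relZ.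
Qed.

Lemma chains_ext n (W : zmodType) (f g : chains n -> W) :
  zmod_morphism f -> zmod_morphism g ->
  (forall a, f (tpure a) = g (tpure a)) -> f =1 g.
Proof.
move=> fB gB fg x; rewrite -[x]reprK; set u := repr _.
pose F : {additive chains n -> W} := HB.pack f (GRing.isZmodMorphism.Build _ _ f fB).
pose G : {additive chains n -> W} := HB.pack g (GRing.isZmodMorphism.Build _ _ g gB).
rewrite -[LHS]/(F _) -[RHS]/(G _) -[u]freeg_sumE !raddf_sum.
apply: eq_bigr => a _; rewrite -[coeff a u]intz -freegU_mulz !raddfMz.
by rewrite -[F _]/(f (tpure a)) fg.
Qed.

Lemma multiadd_comp n (W W' : zmodType) (f : tup n -> W) (g : W -> W') :
  zmod_morphism g -> multiadd f -> multiadd (g \o f).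
Proof.
move=> gB fD a i x y; pose G : {additive W -> W'} :=
  HB.pack g (GRing.isZmodMorphism.Build _ _ g gB).
by rewrite /= fD -[g]/(G : _ -> _) raddfD.
Qed.

Lemma multilin_comp n (W W' : zmodType) (f : tup n -> W) (g : W -> W') :
  zmod_morphism g -> multilin f -> multilin (g \o f).
Proof.
by move=> gB [fD fZ]; split=> [|a i j l ij /=]; [exact: multiadd_comp | rewrite (fZ _ _ _ _ ij)].
Qed.

Lemma eq_multilin n (W : zmodType) (f g : tup n -> W) :
  f =1 g -> multilin f -> multilin g.
Proof. by move=> fg [fD fZ]; split=> [a i x y|a i j l ij]; rewrite -!fg; [exact: fD|exact: fZ]. Qed.

Lemma multiadd_upd n (W : zmodType) (f : tup n -> W) i (h : R -> R) :
  {morph h : x y / x + y} -> multiadd f -> multiadd (fun a => f (upd a i (h (a i)))).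
Proof.
move=> hD fD a j x y; have [->|ij] := eqVneq i j.
  by rewrite !upd_same !upd_upd hD fD.
by rewrite !upd_diff // !(updC _ _ _ (j := i)) 1?eq_sym // fD.
Qed.

Lemma multiadd0 n (W : zmodType) (f : tup n -> W) (a : tup n) i :
  multiadd f -> a i = 0 -> f a = 0.
Proof.
move=> fD a0; rewrite -(upd_id a i) a0.
by apply: (addIr (f (upd a i 0))); rewrite -fD !add0r.
Qed.

Definition homogs n (e : {ffun 'I_n.+1 -> bool}) (a : tup n) : Prop :=
  forall i, homog (e i) (a i).

Lemma multiadd_ext n (W : zmodType) (f g : tup n -> W) :
  multiadd f -> multiadd g -> (forall e a, homogs e a -> f a = g a) -> f =1 g.
Proof.
move=> fD gD fg.
suff H m (e : {ffun 'I_n.+1 -> bool}) (a : tup n) :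
  (forall i : 'I_n.+1, m <= i -> homog (e i) (a i))%N -> f a = g a.
  by move=> a; apply: (H n.+1 [ffun=> false]) => i; rewrite leqNgt ltn_ord.
elim: m e a => [|m IH] e a h; first by apply: (fg e) => i; apply: h.
have [nm|mn] := leqP n.+1 m.
  by apply: (IH e) => i mi; have := ltn_ord i; rewrite ltnNge (leq_trans nm mi).
pose i := Ordinal mn; rewrite -(upd_id a i) -(hcomp_sum (a i)) fD gD.
congr (_ + _); [apply: (IH (upd e i false)) | apply: (IH (upd e i true))] => j;
  rewrite leq_eqVlt => /predU1P[mj|mj].
- have -> : j = i by exact: val_inj.
  by rewrite !upd_same; apply: homog_hcomp.
- have ji : j != i by rewrite -val_eqE /= neq_ltn mj orbT.
  by rewrite !upd_diff //; apply: h.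
- have -> : j = i by exact: val_inj.
  by rewrite !upd_same; apply: homog_hcomp.
- have ji : j != i by rewrite -val_eqE /= neq_ltn mj orbT.
  by rewrite !upd_diff //; apply: h.
Qed.

Fact lscale_multilin n (l : k) :
  multilin (fun a : tup n => tpure (upd a ord0 (lscale l (a ord0)))).
Proof.
split=> [|a i j m ij].
  by apply: (@multiadd_upd n _ _ ord0 (lscale l)); [exact: lscaleDr | exact: (tpure_multilin n).1].
pose b := upd a ord0 (lscale l (a ord0)).
have j0 : j != ord0 by rewrite -val_eqE /= ij.
have -> : upd (upd a j (lscale m (a j))) ord0 (lscale l (upd a j (lscale m (a j)) ord0))
    = upd b j (lscale m (b j)).
  by rewrite /b !upd_diff // 1?eq_sym // (updC _ _ _ j0).
rewrite -((tpure_multilin n).2 b _ _ m ij); congr tpure.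
rewrite /b; have [->|i0] := eqVneq i ord0.
  by rewrite !upd_same !upd_upd lrscale.
by rewrite !upd_diff // 1?eq_sym // (updC _ _ _ i0).
Qed.

Fact rscale_multilin n (l : k) :
  multilin (fun a : tup n => tpure (upd a ord_max (rscale (a ord_max) l))).
Proof.
split=> [|a i j m ij].
  by apply: (@multiadd_upd n _ _ ord_max (rscale^~ l)); [exact: rscaleDl | exact: (tpure_multilin n).1].
pose b := upd a ord_max (rscale (a ord_max) l).
have i0 : i != ord_max by rewrite -val_eqE /= neq_ltn -ltnS -ij ltn_ord.
have -> : upd (upd a i (rscale (a i) m)) ord_max
    (rscale (upd a i (rscale (a i) m) ord_max) l) = upd b i (rscale (b i) m).
  by rewrite /b !upd_diff // 1?eq_sym // (updC _ _ _ i0).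
rewrite ((tpure_multilin n).2 b _ _ m ij); congr tpure.
rewrite /b; have [->|j0] := eqVneq j ord_max.
  by rewrite !upd_same !upd_upd lrscale.
by rewrite !upd_diff // 1?eq_sym // (updC _ _ _ j0).
Qed.

Definition clscale n (l : k) : chains n -> chains n :=
  tlift (fun a : tup n => tpure (upd a ord0 (lscale l (a ord0)))).
Definition crscale n (x : chains n) (l : k) : chains n :=
  tlift (fun a : tup n => tpure (upd a ord_max (rscale (a ord_max) l))) x.

Lemma clscaleE n l (a : tup n) :
  clscale l (tpure a) = tpure (upd a ord0 (lscale l (a ord0))).
Proof. exact/tliftE/lscale_multilin. Qed.
Lemma crscaleE n l (a : tup n) :
  crscale (tpure a) l = tpure (upd a ord_max (rscale (a ord_max) l)).
Proof. exact/tliftE/rscale_multilin. Qed.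
Lemma clscaleB n l : zmod_morphism (@clscale n l).
Proof. exact/tliftB/lscale_multilin. Qed.
Lemma crscaleB n l : zmod_morphism ((@crscale n)^~ l).
Proof. exact/tliftB/rscale_multilin. Qed.

Fact clscaleA n l m (x : chains n) : clscale l (clscale m x) = clscale (l * m) x.
Proof.
move: x; apply: chains_ext => [x y|x y|a]; rewrite ?clscaleB //.
by rewrite !clscaleE upd_same upd_upd lscaleA.
Qed.
Fact clscale1 n : left_id 1 (@clscale n).
Proof.
apply: chains_ext => [x y|x y|a]; rewrite ?clscaleB //.
by rewrite clscaleE lscale1 upd_id.
Qed.
Fact clscaleDr n : right_distributive (@clscale n) +%R.
Proof.
move=> l x y; pose G : {additive chains n -> chains n} :=
  HB.pack (@clscale n l) (GRing.isZmodMorphism.Build _ _ _ (@clscaleB n l)).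
exact: (raddfD G).
Qed.
Fact clscaleDl n (x : chains n) : {morph (@clscale n)^~ x : l m / l + m}.
Proof.
move=> l m; move: x; apply: chains_ext => [x y|x y|a]; rewrite ?clscaleB //.
  by rewrite opprD addrACA.
by rewrite !clscaleE lscaleDl (tpure_multilin n).1.
Qed.
HB.instance Definition _ n := GRing.Zmodule_isLmodule.Build k (chains n)
  (@clscaleA n) (@clscale1 n) (@clscaleDr n) (@clscaleDl n).

Lemma scale_tpure n (l : k) (a : tup n) :
  l *: tpure a = tpure (upd a ord0 (lscale l (a ord0))).
Proof. exact: clscaleE. Qed.

(* A formula f e a given on homogeneous tuples a of parities e, extended additively. *)
Definition hsum n (W : zmodType) (f : {ffun 'I_n.+1 -> bool} -> tup n -> W) (a : tup n) : W :=
  \sum_(e : {ffun 'I_n.+1 -> bool}) f e [ffun i => hcomp (e i) (a i)].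

Lemma hsum_multiadd n (W : zmodType) (f : {ffun 'I_n.+1 -> bool} -> tup n -> W) :
  (forall e, multiadd (f e)) -> multiadd (hsum f).
Proof.
move=> fD a i x y; rewrite -big_split; apply: eq_bigr => e _ /=.
pose b := [ffun j => hcomp (e j) (a j)].
have H z : [ffun j => hcomp (e j) (upd a i z j)] = upd b i (hcomp (e i) z).
  by apply/ffunP=> j; rewrite !ffunE; case: eqP => // ->.
by rewrite !H hcompD fD.
Qed.

Lemma hsumE n (W : zmodType) (f : {ffun 'I_n.+1 -> bool} -> tup n -> W) e a :
  (forall e, multiadd (f e)) -> homogs e a -> hsum f a = f e a.
Proof.
move=> fD ha; rewrite /hsum (bigD1 e) //= big1 ?addr0 => [|d de].
  by congr (f e); apply/ffunP => i; rewrite ffunE ha.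
have [i di] : exists i, d i != e i.
  apply/existsP; apply: contraNT de; rewrite negb_exists => /forallP H.
  by apply/eqP/ffunP => i; apply/eqP; rewrite -[_ == _]negbK.
by apply: (multiadd0 (i := i) (fD d)); rewrite ffunE (hcomp_homog _ (ha i)) (negbTE di).
Qed.

(* |a_0| + ... + |a_(i-1)|, for i at most n+1. *)
Definition psum n (e : {ffun 'I_n.+1 -> bool}) (i : nat) : nat :=
  (\sum_(m < i) e (inord m))%N.

Lemma psumS n (e : {ffun 'I_n.+1 -> bool}) (i : 'I_n.+1) :
  psum e i.+1 = (psum e i + e i)%N.
Proof. by rewrite /psum big_ord_recr /= inord_val. Qed.

Lemma eq_sign (a b : nat) : odd a = odd b -> (-1) ^+ a = (-1) ^+ b :> k.
Proof. by rewrite -(signr_odd _ a) => ->; rewrite signr_odd. Qed.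

Lemma sign_scaleC (W : lmodType k) m (l : k) (w : W) :
  l *: ((-1) ^+ m *: w) = (-1) ^+ m *: (l *: w).
Proof. by rewrite !scalerA commr_sign. Qed.

Lemma multiadd_sign n (W : lmodType k) (f : tup n -> W) (a : tup n) i b x :
  multiadd f -> f (upd a i ((-1) ^+ (nat_of_bool b) * x)) = (-1) ^+ b *: f (upd a i x).
Proof.
move=> fD; case: b; rewrite ?mul1r ?scale1r // mulN1r scaleN1r; apply/eqP.
rewrite -addr_eq0 -fD addNr; apply/eqP/(multiadd0 (i := i)) => //.
exact: upd_same.
Qed.

Definition superlin n (W : lmodType k) (f : tup n -> W) : Prop :=
  multiadd f /\ forall e d (a : tup n) (l : k) (i : 'I_n.+1),
    homogs e a -> homog d l ->
    f (upd a i (lscale l (a i))) = (-1) ^+ (d * psum e i) *: (l *: f a).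

Lemma superlin_multilin n (W : lmodType k) (f : tup n -> W) :
  superlin f -> multilin f.
Proof.
move=> [fD fS]; split=> // a i j l ij.
suff H d (m : k) : homog d m ->
    f (upd a i (rscale (a i) m)) = f (upd a j (lscale m (a j))).
  by rewrite -(hcomp_sum l) rscaleDr lscaleDl !fD !(H _ _ (homog_hcomp _ _)).
move=> hm; move: a; apply: multiadd_ext.
- by apply: (@multiadd_upd n _ _ i (rscale^~ m)) => //; apply: rscaleDl.
- by apply: (@multiadd_upd n _ _ j (lscale m)) => //; apply: lscaleDr.
move=> e a ha; rewrite (rscaleSC hm (ha i)) multiadd_sign // !(fS _ _ _ _ _ ha hm).
rewrite scalerA -exprD ij psumS; congr (_ *: _); apply: eq_sign.
by rewrite mulnDr addnC; case: (d); case: (e i).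
Qed.

Lemma tlift_linear n (W : lmodType k) (f : tup n -> W) : multilin f ->
  (forall a l, f (upd a ord0 (lscale l (a ord0))) = l *: f a) -> linear (tlift f).
Proof.
move=> fl fZ; have fB := tliftB fl.
pose F : {additive chains n -> W} := HB.pack (tlift f) (GRing.isZmodMorphism.Build _ _ _ fB).
suff H l x : tlift f (l *: x) = l *: tlift f x.
  by move=> l x y; rewrite -H -[LHS]/(F _) raddfD.
move: x; apply: chains_ext => [x y|x y|a].
- by rewrite scalerBr fB.
- by rewrite fB scalerBr.
by rewrite scale_tpure !tliftE.
Qed.

Lemma superlin_linear n (W : lmodType k) (f : tup n -> W) :
  superlin f -> linear (tlift f).
Proof.
move=> fS; have fl := superlin_multilin fS; apply: tlift_linear => // a l.
move: a; apply: multiadd_ext.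
- by apply: (@multiadd_upd n _ _ ord0 (lscale l)); [exact: lscaleDr | exact: fl.1].
- by apply: multiadd_comp fl.1 => x y; rewrite scalerBr.
move=> e a ha; suff H d (m : k) : homog d m ->
    f (upd a ord0 (lscale m (a ord0))) = m *: f a.
  by rewrite -(hcomp_sum l) lscaleDl fl.1 !(H _ _ (homog_hcomp _ _)) scalerDl.
by move=> hm; rewrite (fS.2 _ _ _ _ _ ha hm) /psum big_ord0 muln0 scale1r.
Qed.

Lemma tpure_superlin n : superlin (@tpure n).
Proof.
split=> [|e d a l [i lti] ha hl]; first exact: (tpure_multilin n).1.
elim: i lti => [|i IH] lti.
  rewrite /psum big_ord0 muln0 scale1r scale_tpure.
  by congr (tpure (upd a _ (lscale l (a _)))); apply: val_inj.
have lti' := ltnW lti; pose i' := Ordinal lti'.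
rewrite -((tpure_multilin n).2 a i' _ l) //.
rewrite (rscaleSC hl (ha i')) multiadd_sign ?IH; last exact: (tpure_multilin n).1.
rewrite scalerA -exprD /= (psumS e i'); congr (_ *: _); apply: eq_sign.
by rewrite mulnDr addnC; case: (d); case: (e i').
Qed.

(* (a_n, a_0, ..., a_(n-1)), and the exponent |a_n|(|a_0| + ... + |a_(n-1)|) of
   the sign it carries. *)
Definition rotT n (T : Type) (a : {ffun 'I_n.+1 -> T}) : {ffun 'I_n.+1 -> T} :=
  [ffun j : 'I_n.+1 => if j == ord0 then a ord_max else a (inord j.-1)].

Definition koszul n (e : {ffun 'I_n.+1 -> bool}) : nat :=
  (e ord_max * \sum_(m < n) e (inord m))%N.

Lemma rotT_updS n (T : Type) (a : {ffun 'I_n.+1 -> T}) (i : nat) x : (i < n)%N ->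
  rotT (upd a (inord i) x) = upd (rotT a) (inord i.+1) x.
Proof.
move=> lin; apply/ffunP=> j.
have jn : (j.-1 < n.+1)%N by rewrite (leq_ltn_trans (leq_pred _)).
rewrite !ffunE -!val_eqE /= !inordK // 1?ltnW //.
have [->|j0] := eqVneq (nat_of_ord j) 0%N; first by rewrite eq_sym (ltn_eqF lin).
suff -> : (nat_of_ord j == i.+1) = ((nat_of_ord j).-1 == i) by [].
by case: (nat_of_ord j) j0.
Qed.

Lemma rotT_upd_max n (T : Type) (a : {ffun 'I_n.+1 -> T}) x :
  rotT (upd a ord_max x) = upd (rotT a) ord0 x.
Proof.
apply/ffunP=> j; rewrite !ffunE eqxx -!val_eqE /=.
have [//|j0] := eqVneq (j : nat) 0%N.
have jn : (j.-1 < n)%N by rewrite -ltnS prednK ?lt0n.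
by rewrite inordK ?(ltn_eqF jn) // ltnW.
Qed.

Lemma rotT_homogs n e (a : tup n) : homogs e a -> homogs (rotT e) (rotT a).
Proof. by move=> ha i; rewrite !ffunE; case: ifP. Qed.

Lemma psum_rotT n (e : {ffun 'I_n.+1 -> bool}) (i : nat) : (i <= n)%N ->
  psum (rotT e) i.+1 = (e ord_max + psum e i)%N.
Proof.
move=> lin; rewrite /psum big_ord_recl /=; congr (_ + _)%N.
  by rewrite ffunE -val_eqE /= inordK.
apply: eq_bigr => m _; rewrite ffunE -val_eqE /= /bump leq0n add1n inordK //.
by rewrite ltnS (leq_trans (ltn_ord m)).
Qed.

Definition flip n (e : {ffun 'I_n.+1 -> bool}) i (d : bool) := upd e i (d (+) e i).

Lemma flip_homogs n e (a : tup n) i d l : homogs e a -> homog d l ->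
  homogs (flip e i d) (upd a i (lscale l (a i))).
Proof.
move=> ha hl j; rewrite !ffunE; case: eqP => _ //.
exact: homogZ.
Qed.

Lemma odd_psum_flip n (e : {ffun 'I_n.+1 -> bool}) (i : 'I_n.+1) d m :
  (m <= n.+1)%N -> odd (psum (flip e i d) m) = odd (psum e m) (+) (d && (i < m)%N).
Proof.
elim: m => [_|m IH mn]; first by rewrite /psum !big_ord0 andbF.
rewrite /psum !big_ord_recr /= !oddD -![odd (\sum_(_ < m) _)]/(odd (psum _ m)).
rewrite IH ?(ltnW mn) // ffunE -val_eqE /= inordK //.
have [im|mi|im] := ltngtP i m.
- by rewrite ltnS (ltnW im) addbAC.
- by rewrite ltnS leqNgt mi andbF !addbF.
have -> : inord m = i by apply: val_inj; rewrite /= inordK.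
by rewrite im ltnSn andbT andbF addbF !oddb -addbA (addbC (e i)).
Qed.

Lemma rotT_superlin n (c : nat) : superlin
  (hsum (fun e (a : tup n) => (-1) ^+ (c + koszul e) *: tpure (rotT a))).
Proof.
have fD (e : {ffun 'I_n.+1 -> bool}) :
    multiadd (fun a : tup n => (-1) ^+ (c + koszul e) *: tpure (rotT a)).
  apply: multiadd_comp => [x y|a i x y]; first by rewrite scalerBr.
  have [->|ni] := eqVneq i ord_max; first by rewrite !rotT_upd_max (tpure_multilin n).1.
  have lin : (i < n)%N by rewrite ltn_neqAle -ltnS ltn_ord andbT.
  by rewrite -[i]inord_val !rotT_updS // (tpure_multilin n).1.
split=> [|e d a l i ha hl]; first exact: hsum_multiadd.
rewrite (hsumE fD (flip_homogs i ha hl)) (hsumE fD ha) sign_scaleC.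
have hr := rotT_homogs ha.
have [->|ni] := eqVneq i ord_max.
  have -> : a ord_max = rotT a ord0 by rewrite ffunE.
  rewrite rotT_upd_max ((tpure_superlin n).2 _ _ _ _ _ hr hl) [LHS]scalerA [RHS]scalerA -!exprD.
  congr (_ *: _); apply: eq_sign.
  have -> : psum (rotT e) (@ord0 n) = 0%N by rewrite /psum big_ord0.
  rewrite muln0 addn0 !oddD !oddM /=.
  rewrite -![\sum_(m < n) _]/(psum _ n) odd_psum_flip // ltnn andbF addbF.
  rewrite /flip upd_same !oddb.
  by case: (odd c); case: d {hl}; case: (e _); case: (odd _).
have lin : (i < n)%N by rewrite ltn_neqAle -ltnS ltn_ord andbT.
have -> : a i = rotT a (inord i.+1).
  by rewrite ffunE -val_eqE /= inordK //= inord_val.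
have E x : rotT (upd a i x) = upd (rotT a) (inord i.+1) x.
  by rewrite -{1}[i]inord_val rotT_updS.
rewrite E ((tpure_superlin n).2 _ _ _ _ _ hr hl).
rewrite [LHS]scalerA [RHS]scalerA -!exprD inordK // psum_rotT ?(ltnW lin) //.
congr (_ *: _); apply: eq_sign; rewrite !oddD !oddM.
rewrite -![\sum_(m < n) _]/(psum _ n) odd_psum_flip // lin andbT.
rewrite /flip upd_diff 1?eq_sym // oddD !oddb.
by case: (odd c); case: d {hl}; case: (e _); case: (odd _); case: (odd _).
Qed.

Definition mergeT n (i : nat) (a : tup n.+1) : tup n :=
  [ffun j : 'I_n.+1 => if (j < i)%N then a (inord j)
    else if j == i :> nat then a (inord i) * a (inord i.+1) else a (inord j.+1)].

Definition wrapT n (a : tup n.+1) : tup n :=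
  [ffun j : 'I_n.+1 => if j == ord0 then a ord_max * a ord0 else a (inord j)].

(* d_i for 0 <= i <= n+1; the last one brings a_(n+1) to the front. *)
Definition face n (i : nat) : chains n.+1 -> chains n :=
  if (i <= n)%N then tlift (fun a : tup n.+1 => tpure (mergeT i a))
  else tlift (hsum (fun e (a : tup n.+1) => (-1) ^+ koszul e *: tpure (wrapT a))).

Definition cyct n : chains n -> chains n :=
  tlift (hsum (fun e (a : tup n) => (-1) ^+ (n + koszul e) *: tpure (rotT a))).

Definition bdiff n (x : chains n.+1) : chains n :=
  \sum_(i < n.+2) (-1) ^+ i *: face i x.
Definition bdiff' n (x : chains n.+1) : chains n :=
  \sum_(i < n.+1) (-1) ^+ i *: face i x.
Definition cycN n (x : chains n) : chains n := \sum_(i < n.+1) iter i (@cyct n) x.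
Definition cycT n (x : chains n) : chains n := x - cyct x.

Section MergeUpd.
Variables (n i : nat) (a : tup n.+1) (m : 'I_n.+2) (x : R).
Hypothesis lin : (i <= n)%N.

Let mergeTE (b : tup n.+1) (j : 'I_n.+1) : mergeT i b j = if (j < i)%N then b (inord j)
    else if j == i :> nat then b (inord i) * b (inord i.+1) else b (inord j.+1).
Proof. by rewrite ffunE. Qed.

Let upd_inord N (T : Type) (b : {ffun 'I_N.+1 -> T}) (p : 'I_N.+1) y t : (t <= N)%N ->
  upd b p y (inord t) = if t == p then y else b (inord t).
Proof. by move=> tN; rewrite ffunE -val_eqE /= inordK. Qed.

Let updE N (T : Type) (b : {ffun 'I_N.+1 -> T}) (j : 'I_N.+1) y t : (t <= N)%N ->
  upd b (inord t) y j = if j == t :> nat then y else b j.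
Proof. by move=> tN; rewrite ffunE -val_eqE /= inordK. Qed.

Local Ltac merge_tac := apply/ffunP => j; have jn := ltn_ord j; have mn := ltn_ord m;
  rewrite updE ?mergeTE ?upd_inord //; try lia;
  repeat (case: ifP => ? //); solve [lia | congr (_ * _); lia | by []].

Lemma mergeT_lt : (m < i)%N -> mergeT i (upd a m x) = upd (mergeT i a) (inord m) x.
Proof. by move=> h; merge_tac. Qed.

Lemma mergeT_eq : m = i :> nat ->
  mergeT i (upd a m x) = upd (mergeT i a) (inord i) (x * a (inord i.+1)).
Proof. by move=> h; merge_tac. Qed.

Lemma mergeT_eqS : m = i.+1 :> nat ->
  mergeT i (upd a m x) = upd (mergeT i a) (inord i) (a (inord i) * x).
Proof. by move=> h; merge_tac. Qed.

Lemma mergeT_gt : (i.+1 < m)%N -> mergeT i (upd a m x) = upd (mergeT i a) (inord m.-1) x.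
Proof. by move=> h; merge_tac. Qed.
End MergeUpd.

Lemma mergeT_inord n i (a : tup n.+1) t : (t <= n)%N ->
  mergeT i a (inord t) = if (t < i)%N then a (inord t)
    else if t == i then a (inord i) * a (inord i.+1) else a (inord t.+1).
Proof. by move=> tn; rewrite ffunE !inordK. Qed.

Lemma mergeT_multilin n i : (i <= n)%N -> multilin (fun a : tup n.+1 => tpure (mergeT i a)).
Proof.
move=> lin; have [tD tZ] := tpure_multilin n; split=> [a m x y|a p q l qp].
  have [mi|im|mi] := ltngtP m i; first by rewrite !mergeT_lt.
    have [mi|mi|mi] := ltngtP m i.+1; first by lia.
      by rewrite !mergeT_gt.
    by rewrite !mergeT_eqS // mulrDr.
  by rewrite !mergeT_eq // mulrDl.
have qn := ltn_ord q.
have [pi|ip|pi] := ltngtP p i.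
- rewrite mergeT_lt //.
  have -> : a p = mergeT i a (inord p) by rewrite mergeT_inord ?pi ?inord_val //; lia.
  rewrite (tZ _ _ (inord q)); last by rewrite !inordK //; lia.
  congr tpure; have [qi|qi] : (q < i)%N \/ q = i :> nat by lia.
    by rewrite mergeT_lt // mergeT_inord ?qi ?inord_val //; lia.
  rewrite mergeT_eq // mergeT_inord qi ?ltnn ?eqxx //.
  by rewrite lscaleAl -qi inord_val.
- have [pi|pi] : p = i.+1 :> nat \/ (i.+1 < p)%N by lia.
    rewrite mergeT_eqS // mergeT_gt //; last by lia.
    have -> : a (inord i) * rscale (a p) l = rscale (mergeT i a (inord i)) l.
      by rewrite mergeT_inord // ltnn eqxx rscaleAr -pi inord_val.
    have -> : a q = mergeT i a (inord q.-1).
      rewrite mergeT_inord; last by lia.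
      by rewrite qp pi /= ltnNge leqnSn gtn_eqF //= -pi -qp inord_val.
    by rewrite (tZ _ _ (inord q.-1)) // !inordK //; lia.
  rewrite mergeT_gt // mergeT_gt //; last by lia.
  have E (r : 'I_n.+2) : (i.+1 < r)%N -> a r = mergeT i a (inord r.-1).
    move=> ir; have rn := ltn_ord r; rewrite mergeT_inord; last by lia.
    rewrite ifF ?ifF ?prednK ?inord_val //; lia.
  rewrite (E p) // (E q); last by lia.
  by rewrite (tZ _ _ (inord q.-1)) // !inordK //; lia.
rewrite mergeT_eq // mergeT_eqS //; last by lia.
have -> : inord i.+1 = q by apply: val_inj; rewrite /= inordK; lia.
have -> : inord i = p by apply: val_inj; rewrite /= inordK; lia.
by rewrite rscaleMl.
Qed.

Lemma mergeT_lscale n i (a : tup n.+1) l : (i <= n)%N ->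
  tpure (mergeT i (upd a ord0 (lscale l (a ord0)))) = l *: tpure (mergeT i a).
Proof.
move=> lin; rewrite scale_tpure.
have E0 : inord 0 = ord0 :> 'I_n.+1 by apply: val_inj; rewrite /= inordK.
have E0' : inord 0 = ord0 :> 'I_n.+2 by apply: val_inj; rewrite /= inordK.
have := mergeT_inord i a (leq0n n); rewrite E0 E0' => ->.
case: i lin => [|i] lin; last by rewrite mergeT_lt // E0.
by rewrite mergeT_eq //= E0 E0' lscaleAl.
Qed.

Lemma wrapTE n (a : tup n.+1) : wrapT a = mergeT 0 (rotT a).
Proof.
have E0 : inord 0 = ord0 :> 'I_n.+2 by apply: val_inj; rewrite /= inordK.
apply/ffunP=> j; have jn := ltn_ord j.
rewrite !ffunE -!val_eqE /= !inordK //=.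
by rewrite E0.
Qed.

Fact cyct_linear n : linear (@cyct n).
Proof. exact/superlin_linear/rotT_superlin. Qed.
HB.instance Definition _ n := GRing.isLinear.Build k _ _ _ (@cyct n) (@cyct_linear n).

Lemma cyctE n (a : tup n) : cyct (tpure a) =
  hsum (fun e (a : tup n) => (-1) ^+ (n + koszul e) *: tpure (rotT a)) a.
Proof. exact/tliftE/superlin_multilin/rotT_superlin. Qed.

Lemma face_lt_linear n i : (i <= n)%N -> linear (@face n i).
Proof.
move=> lin; rewrite /face lin; apply: tlift_linear; first exact: mergeT_multilin.
by move=> a l; apply: mergeT_lscale.
Qed.

Fact face_linear n i : linear (@face n i).
Proof.
have [|ni] := leqP i n; first exact: face_lt_linear.
pose f0 : {linear chains n.+1 -> chains n} := HB.pack (@face n 0)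
  (GRing.isLinear.Build k _ _ _ (@face n 0) (face_lt_linear (leq0n n))).
have E a : hsum (fun e (a : tup n.+1) => (-1) ^+ koszul e *: tpure (wrapT a)) a =
    (-1) ^+ n.+1 *: f0 (cyct (tpure a)).
  rewrite cyctE /hsum raddf_sum scaler_sumr; apply: eq_bigr => e _ /=.
  rewrite -[face 0 _]/(f0 _) linearZ /= scalerA exprD mulrA -expr2 sqrr_sign mul1r wrapTE.
  by rewrite /face /= tliftE //; apply: mergeT_multilin.
rewrite /face leqNgt ni /=; apply: tlift_linear.
  apply: (eq_multilin (fsym E)).
  apply: (multilin_comp (g := fun x => (-1) ^+ n.+1 *: f0 (cyct x))) => [x y|].
    by rewrite !raddfB.
  exact: tpure_multilin.
move=> a l; rewrite !E -scale_tpure !linearZ /=.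
by rewrite sign_scaleC.
Qed.
HB.instance Definition _ n i := GRing.isLinear.Build k _ _ _ (@face n i) (@face_linear n i).

Fact bdiff_linear n : linear (@bdiff n).
Proof.
move=> l x y; rewrite /bdiff scaler_sumr -big_split; apply: eq_bigr => i _ /=.
by rewrite linearP scalerDr sign_scaleC.
Qed.
HB.instance Definition _ n := GRing.isLinear.Build k _ _ _ (@bdiff n) (@bdiff_linear n).

Fact bdiff'_linear n : linear (@bdiff' n).
Proof.
move=> l x y; rewrite /bdiff' scaler_sumr -big_split; apply: eq_bigr => i _ /=.
by rewrite linearP scalerDr sign_scaleC.
Qed.
HB.instance Definition _ n := GRing.isLinear.Build k _ _ _ (@bdiff' n) (@bdiff'_linear n).

Fact cycN_linear n : linear (@cycN n).
Proof.
move=> l x y; rewrite /cycN scaler_sumr -big_split; apply: eq_bigr => i _ /=.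
by elim: (nat_of_ord i) => //= m ->; rewrite linearP.
Qed.
HB.instance Definition _ n := GRing.isLinear.Build k _ _ _ (@cycN n) (@cycN_linear n).

Fact cycT_linear n : linear (@cycT n).
Proof. by move=> l x y; rewrite /cycT linearP opprD addrACA scalerBr. Qed.
HB.instance Definition _ n := GRing.isLinear.Build k _ _ _ (@cycT n) (@cycT_linear n).

End TensorPower.

Section Bicomplex.
Variable k : pzRingType.

(* i is the column and j the row. The identities between the differentials are
   not recorded: below, homology is cycles modulo those boundaries that are
   cycles, which for a bicomplex is every boundary. *)
Record bicomplex := Bicomplex {
  bobj :> nat -> nat -> lmodType k;
  vdiff : forall i j, {linear bobj i j.+1 -> bobj i j};
  hdiff : forall i j, {linear bobj i.+1 j -> bobj i j}
}.

Record bimorphism (X Y : bicomplex) := Bimorphism {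
  bmap :> forall i j, {linear X i j -> Y i j};
  bmap_vdiff : forall i j x, bmap i j (vdiff X i j x) = vdiff Y i j (bmap i j.+1 x);
  bmap_hdiff : forall i j x, bmap i j (hdiff X i j x) = hdiff Y i j (bmap i.+1 j x)
}.

Section Total.
Variable X : bicomplex.

Definition bfam : Type := forall i j, X i j.
HB.instance Definition _ := Choice.on bfam.

Definition bfam0 : bfam := fun i j => 0.
Definition bfamN (x : bfam) : bfam := fun i j => - x i j.
Definition bfamD (x y : bfam) : bfam := fun i j => x i j + y i j.
Definition bfamZ (l : k) (x : bfam) : bfam := fun i j => l *: x i j.

Lemma bfamP (x y : bfam) : (forall i j, x i j = y i j) -> x = y.
Proof. by move=> xy; apply: functional_extensionality_dep => i; apply: functional_extensionality_dep. Qed.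

Fact bfamA : associative bfamD. Proof. by move=> x y z; apply: bfamP => i j; apply: addrA. Qed.
Fact bfamC : commutative bfamD. Proof. by move=> x y; apply: bfamP => i j; apply: addrC. Qed.
Fact bfam0D : left_id bfam0 bfamD. Proof. by move=> x; apply: bfamP => i j; apply: add0r. Qed.
Fact bfamND : left_inverse bfam0 bfamN bfamD. Proof. by move=> x; apply: bfamP => i j; apply: addNr. Qed.
HB.instance Definition _ := GRing.isZmodule.Build bfam bfamA bfamC bfam0D bfamND.

Fact bfamZA l m x : bfamZ l (bfamZ m x) = bfamZ (l * m) x. Proof. by apply: bfamP => i j; apply: scalerA. Qed.
Fact bfamZ1 : left_id 1 bfamZ. Proof. by move=> x; apply: bfamP => i j; apply: scale1r. Qed.
Fact bfamZDr : right_distributive bfamZ +%R. Proof. by move=> l x y; apply: bfamP => i j; apply: scalerDr. Qed.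
Fact bfamZDl x : {morph bfamZ^~ x : l m / l + m}. Proof. by move=> l m; apply: bfamP => i j; apply: scalerDl. Qed.
HB.instance Definition _ := GRing.Zmodule_isLmodule.Build k bfam bfamZA bfamZ1 bfamZDr bfamZDl.

(* Tot_n is the set of families supported on the antidiagonal i + j = n; this
   finite direct sum is thus taken inside one fixed module. *)
Definition tot (n : nat) (x : bfam) : Prop := forall i j, (i + j)%N != n -> x i j = 0.

(* The sign makes the commuting squares anticommute: b' is replaced by -b'. *)
Definition tdiff (x : bfam) : bfam :=
  fun i j => (-1) ^+ i *: vdiff X i j (x i j.+1) + hdiff X i j (x i.+1 j).

Fact tdiff_linear : linear tdiff.
Proof.
move=> l x y; apply: bfamP => i j; rewrite /tdiff.
rewrite -![(l *: x + y) _ _]/(l *: x _ _ + y _ _) !linearP.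
rewrite -[RHS]/(l *: (_ + _) + (_ + _)) !scalerDr !scalerA commr_sign.
by rewrite -!addrA; congr (_ + _); rewrite addrCA.
Qed.
HB.instance Definition _ := GRing.isLinear.Build k _ _ _ tdiff tdiff_linear.

Definition is_cycle (n : nat) : {pred bfam} := fun x => `[< tot n x /\ tdiff x = 0 >].

Fact is_cycle_submod n : submod_closed (is_cycle n).
Proof.
split=> [|l x y /asboolP[xn x0] /asboolP[yn y0]]; apply/asboolP; split.
- by [].
- exact: linear0.
- move=> i j ij; rewrite -[LHS]/(l *: x i j + y i j).
  by rewrite xn // yn // scaler0 addr0.
- by rewrite linearP /= x0 y0 scaler0 addr0.
Qed.
HB.instance Definition _ n := GRing.isSubmodClosed.Build k bfam (is_cycle n) (is_cycle_submod n).

Record cycles (n : nat) := Cycle { cycle_val :> bfam; _ : cycle_val \in is_cycle n }.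
HB.instance Definition _ n := [isSub for @cycle_val n].
HB.instance Definition _ n := [Choice of cycles n by <:].
HB.instance Definition _ n := [SubChoice_isSubLmodule of cycles n by <:].

Definition is_boundary (n : nat) : {pred cycles n} :=
  fun z => `[< exists2 y, tot n.+1 y & \val z = tdiff y >].

Fact is_boundary_submod n : submod_closed (@is_boundary n).
Proof.
split=> [|l x y /asboolP[u un xu] /asboolP[v vn yv]]; apply/asboolP.
  by exists 0; rewrite ?linear0 ?raddf0.
exists (l *: u + v); last by rewrite !linearP /= xu yv.
move=> i j ij; rewrite -[LHS]/(l *: u i j + v i j).
by rewrite un // vn // scaler0 addr0.
Qed.
HB.instance Definition _ n :=
  GRing.isSubmodClosed.Build k (cycles n) (@is_boundary n) (@is_boundary_submod n).

Definition homology (n : nat) : Type := Quotient.quot (@is_boundary n).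
HB.instance Definition _ n := GRing.Zmodule.on (homology n).

Definition hclass n (z : cycles n) : homology n := \pi_(Quotient.quot (@is_boundary n)) z.

Lemma hclassB n : zmod_morphism (@hclass n).
Proof. exact: raddfB. Qed.
HB.instance Definition _ n :=
  GRing.isZmodMorphism.Build _ _ (@hclass n) (@hclassB n).

Lemma hclass_eq0 n (z : cycles n) : (hclass z == 0) = (z \in @is_boundary n).
Proof. by rewrite /hclass -[z in RHS]subr0 Quotient.idealrBE raddf0. Qed.

Definition hrepr n (c : homology n) : cycles n := repr (c : Quotient.quot (@is_boundary n)).

Lemma hreprK n : cancel (@hrepr n) (@hclass n).
Proof. by move=> c; apply: reprK. Qed.

Definition hscale n (l : k) (c : homology n) : homology n := hclass (l *: hrepr c).

Lemma hscale_class n l (z : cycles n) : hscale l (hclass z) = hclass (l *: z).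
Proof.
apply/eqP; rewrite -subr_eq0 -raddfB hclass_eq0 -scalerBr rpredZ //.
by rewrite -hclass_eq0 raddfB /= hreprK subrr.
Qed.

Fact hscaleA n l m (c : homology n) : hscale l (hscale m c) = hscale (l * m) c.
Proof. by rewrite -(hreprK c) !hscale_class scalerA. Qed.
Fact hscale1 n : left_id 1 (@hscale n).
Proof. by move=> c; rewrite -(hreprK c) hscale_class scale1r. Qed.
Fact hscaleDr n : right_distributive (@hscale n) +%R.
Proof.
move=> l c d; rewrite -(hreprK c) -(hreprK d) -raddfD !hscale_class -raddfD.
by rewrite scalerDr.
Qed.
Fact hscaleDl n (c : homology n) : {morph (@hscale n)^~ c : l m / l + m}.
Proof. by move=> l m; rewrite -(hreprK c) !hscale_class scalerDl raddfD. Qed.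
HB.instance Definition _ n := GRing.Zmodule_isLmodule.Build k (homology n)
  (@hscaleA n) (@hscale1 n) (@hscaleDr n) (@hscaleDl n).

Fact hclass_linear n : linear (@hclass n).
Proof. by move=> l x y; rewrite raddfD /= -hscale_class. Qed.
HB.instance Definition _ n := GRing.isLinear.Build k _ _ _ (@hclass n) (@hclass_linear n).

End Total.

Section HomologyMap.
Variables (X Y : bicomplex) (F : bimorphism X Y).

Definition fmap (x : bfam X) : bfam Y := fun i j => F i j (x i j).

Fact fmap_linear : linear fmap.
Proof. by move=> l x y; apply: bfamP => i j; apply: linearP. Qed.
HB.instance Definition _ := GRing.isLinear.Build k _ _ _ fmap fmap_linear.

Lemma fmap_tot n x : tot n x -> tot n (fmap x).
Proof. by move=> xn i j ij; rewrite /fmap xn // linear0. Qed.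

Lemma fmap_tdiff x : tdiff (fmap x) = fmap (tdiff x).
Proof.
apply: bfamP => i j.
by rewrite /tdiff /fmap linearD linearZ /= bmap_vdiff bmap_hdiff.
Qed.

Fact fmap_cycle n (z : cycles X n) : fmap z \in @is_cycle Y n.
Proof.
have /asboolP[xn x0] := valP z; apply/asboolP; split; first exact: fmap_tot.
by rewrite fmap_tdiff x0 linear0.
Qed.
Definition cycles_map n (z : cycles X n) : cycles Y n := Cycle (fmap_cycle z).

Fact cycles_map_linear n : linear (@cycles_map n).
Proof. by move=> l x y; apply: val_inj; rewrite /= linearP. Qed.
HB.instance Definition _ n := GRing.isLinear.Build k _ _ _ (@cycles_map n) (@cycles_map_linear n).

Definition homology_map n (c : homology X n) : homology Y n := hclass (cycles_map (hrepr c)).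

Lemma homology_map_class n (z : cycles X n) :
  homology_map (hclass z) = hclass (cycles_map z).
Proof.
apply/eqP; rewrite -subr_eq0 -!raddfB /= hclass_eq0.
have : hrepr (hclass z) - z \in @is_boundary X n.
  by rewrite -hclass_eq0 raddfB /= hreprK subrr.
case/asboolP => y yn zy; apply/asboolP; exists (fmap y); first exact: fmap_tot.
by rewrite fmap_tdiff -zy.
Qed.

Fact homology_map_linear n : linear (@homology_map n).
Proof.
move=> l c d; rewrite -(hreprK c) -(hreprK d) -linearP !homology_map_class.
by rewrite -!linearP.
Qed.
HB.instance Definition _ n :=
  GRing.isLinear.Build k _ _ _ (@homology_map n) (@homology_map_linear n).

End HomologyMap.
End Bicomplex.

Arguments homology_map {k X Y} F n c.

Section CyclicBicomplex.
Variables (k : superComRingType) (R : superAlgType k).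

Definition CC_vdiff (i j : nat) : {linear chains R j.+1 -> chains R j} :=
  if odd i then (@bdiff' k R j : {linear _ -> _}) else (@bdiff k R j : {linear _ -> _}).

(* From column i.+1 to column i. *)
Definition CC_hdiff (i j : nat) : {linear chains R j -> chains R j} :=
  if odd i.+1 then (@cycT k R j : {linear _ -> _}) else (@cycN k R j : {linear _ -> _}).

Definition CC : bicomplex k :=
  {| bobj := fun _ j => chains R j : lmodType k; vdiff := CC_vdiff; hdiff := CC_hdiff |}.

Definition HC (n : nat) : lmodType k := homology CC n.

End CyclicBicomplex.

Section Supermatrix.
Variables (p q : nat).

Definition supermx (A : Type) : Type := 'M[A]_(p + q).
HB.instance Definition _ (A : pzRingType) := GRing.PzRing.copy (supermx A) 'M[A]_(p + q).

Section Grading.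
Variable A : superRingType.

Definition mxpar (i : 'I_(p + q)) : bool := (p <= i)%N.

(* An entry of the parity e component has parity e in the diagonal blocks and
   the opposite one in the off-diagonal blocks. *)
Definition mxcomp (e : bool) (M : supermx A) : supermx A :=
  \matrix_(i, j) hcomp (e (+) (mxpar i (+) mxpar j)) (M i j).

Fact mxcompD e : {morph mxcomp e : M N / M + N}.
Proof. by move=> M N; apply/matrixP => i j; rewrite !mxE hcompD. Qed.
Fact mxcompI e f M : mxcomp e (mxcomp f M) = if e == f then mxcomp f M else 0.
Proof.
apply/matrixP => i j; rewrite !mxE hcompI (can_eq (addbK _)).
by case: eqP => _; rewrite !mxE.
Qed.
Fact mxcomp_sum M : mxcomp false M + mxcomp true M = M.
Proof.
apply/matrixP => i j; rewrite !mxE.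
by case: (mxpar i (+) mxpar j); rewrite /= ?hcomp_sum // addrC hcomp_sum.
Qed.
HB.instance Definition _ := isSuperZmod.Build (supermx A) mxcompD mxcompI mxcomp_sum.

Lemma mx_homogP e (M : supermx A) :
  homog e M <-> forall i j, homog (e (+) (mxpar i (+) mxpar j)) (M i j).
Proof.
split=> [MM i j|H]; first by rewrite -MM mxE; apply: homog_hcomp.
by apply/matrixP => i j; rewrite mxE H.
Qed.

Fact mx_homog1 : homog false (1 : supermx A).
Proof.
apply/mx_homogP => i j; rewrite mxE; case: eqP => [->|_]; last exact: homog0.
by rewrite addbb; apply: homog1.
Qed.

Fact mx_homogM e f (M N : supermx A) :
  homog e M -> homog f N -> homog (e (+) f) (M * N).
Proof.
move=> /mx_homogP hM /mx_homogP hN; apply/mx_homogP => i j; rewrite mxE.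
rewrite /homog raddf_sum; apply: eq_bigr => m _ /=.
have -> : e (+) f (+) (mxpar i (+) mxpar j) =
  (e (+) (mxpar i (+) mxpar m)) (+) (f (+) (mxpar m (+) mxpar j)).
  by case: e f (mxpar i) (mxpar j) (mxpar m) {hM hN} => [] [] [] [] [].
exact: homogM.
Qed.
HB.instance Definition _ := SuperZmod_isSuperRing.Build (supermx A) mx_homog1 mx_homogM.

Definition str (M : supermx A) : A :=
  \sum_(e : bool) (\tr (ulsubmx (hcomp e M : 'M[A]_(p + q)))
    + (-1) ^+ e.+1 * \tr (drsubmx (hcomp e M : 'M[A]_(p + q)))).

End Grading.

Section Actions.
Variables (k : superComRingType) (A : superAlgType k).

(* diag(l I_p, (-1)^|l| l I_q), the scalar l being read as l 1 in A. *)
Definition sdiag (l : k) : supermx A :=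
  \sum_(e : bool) (block_mx (lscale (hcomp e l) 1)%:M 0
    0 ((-1) ^+ e * lscale (hcomp e l) 1)%:M : 'M[A]_(p + q)).

Definition mxlscale (l : k) (M : supermx A) : supermx A := sdiag l * M.
Definition mxrscale (M : supermx A) (l : k) : supermx A := M * sdiag l.

Lemma lscale1C e f (l : k) (a : A) : homog e l -> homog f a ->
  lscale l 1 * a = (-1) ^+ (e && f) * (a * lscale l 1).
Proof.
move=> hl ha; rewrite -lscaleAl mul1r (lscaleSC _ _ _ _ hl ha); congr (_ * _).
by rewrite (lscaleSC _ _ _ _ hl (homog1 : homog false (1 : A))) andbF mul1r -rscaleAr mulr1.
Qed.

Definition twist (b : bool) (l : k) : A := \sum_(e : bool) (-1) ^+ (e && b) * lscale (hcomp e l) 1.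

Lemma twistD b : {morph twist b : l m / l + m}.
Proof.
move=> l m; rewrite /twist -big_split; apply: eq_bigr => e _ /=.
by rewrite hcompD lscaleDl mulrDr.
Qed.

Lemma twist_homog b e l : homog e l -> twist b l = (-1) ^+ (e && b) * lscale l 1.
Proof.
move=> hl; rewrite /twist (bigD1 e) //= hl big1 ?addr0 // => f fe.
have l0 : lscale (0 : k) (1 : A) = 0.
  by apply: (addIr (lscale (0 : k) 1)); rewrite -lscaleDl !add0r.
by rewrite (hcomp_homog _ hl) (negbTE fe) l0 mulr0.
Qed.

Lemma homog_twist b e l : homog e l -> homog e (twist b l).
Proof.
move=> hl; rewrite (twist_homog b hl).
have h1 : homog e (lscale l (1 : A)) by rewrite -[e]addbF; apply/homogZ/homog1.
by case: (e && b); rewrite ?mul1r // mulN1r; apply: homogN.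
Qed.

Lemma twist1 b : twist b 1 = 1.
Proof. by rewrite (twist_homog b homog1) mul1r lscale1. Qed.

Lemma twistM b l m : twist b (l * m) = twist b l * twist b m.
Proof.
suff H e f (x y : k) : homog e x -> homog f y -> twist b (x * y) = twist b x * twist b y.
  rewrite -(hcomp_sum l) -(hcomp_sum m) !mulrDl !mulrDr !twistD !mulrDl !mulrDr.
  by rewrite !(H _ _ _ _ (homog_hcomp _ _) (homog_hcomp _ _)).
move=> hx hy; rewrite (twist_homog b (homogM _ _ _ _ hx hy)).
rewrite (twist_homog b hx) (twist_homog b hy) -lscaleA.
have -> : lscale x (lscale y (1 : A)) = lscale x 1 * lscale y 1.
  by rewrite -[in RHS]lscaleAl mul1r.
by case: e f b {hx hy} => [] [] []; rewrite /= ?mul1r ?mulN1r ?mulrN ?mulNr ?opprK.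
Qed.

Lemma sdiagE l i j : sdiag l i j = if i == j then twist (mxpar i) l else 0.
Proof.
rewrite /sdiag summxE.
have [<-|ij] := eqVneq i j; last first.
  apply: big1 => e _; rewrite !mxE; case: splitP => i' ii; rewrite !mxE; case: splitP => j' jj;
  rewrite !mxE //; case: eqP => // E; case/eqP: ij; apply: val_inj => /=; rewrite ii jj E //.
apply: eq_bigr => e _; rewrite !mxE /mxpar.
case: splitP => i' ii; rewrite !mxE; case: splitP => j' jj; rewrite ?mxE.
- have -> : j' = i' by apply: val_inj; rewrite /= -ii.
  by rewrite eqxx ii leqNgt ltn_ord andbF mul1r.
- by move: (ltn_ord i'); rewrite -ii jj ltnNge leq_addr.
- by move: (ltn_ord j'); rewrite -jj ii ltnNge leq_addr.
have -> : j' = i' by apply: val_inj; apply/eqP; rewrite -(eqn_add2l p) -jj -ii.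
by rewrite eqxx ii leq_addr andbT.
Qed.

Lemma sdiagD : {morph sdiag : l m / l + m}.
Proof.
move=> l m; apply/matrixP => i j; rewrite mxE !sdiagE.
by case: eqP; rewrite ?twistD ?addr0.
Qed.
Lemma sdiag1 : sdiag 1 = 1.
Proof. by apply/matrixP => i j; rewrite sdiagE twist1 mxE; case: eqP. Qed.

Lemma mxlscaleE l M i j : mxlscale l M i j = twist (mxpar i) l * M i j.
Proof.
rewrite mxE (bigD1 i) //= sdiagE eqxx big1 ?addr0 // => m mi.
by rewrite sdiagE eq_sym (negbTE mi) mul0r.
Qed.
Lemma mxrscaleE M l i j : mxrscale M l i j = M i j * twist (mxpar j) l.
Proof.
rewrite mxE (bigD1 j) //= sdiagE eqxx big1 ?addr0 // => m mj.
by rewrite sdiagE (negbTE mj) mulr0.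
Qed.

Lemma sdiagM l m : sdiag (l * m) = sdiag l * sdiag m.
Proof.
apply/matrixP => i j; rewrite -[sdiag l * _]/(mxlscale l _) mxlscaleE !sdiagE twistM.
by case: eqP; rewrite ?mulr0.
Qed.

Lemma sdiag_homog e l : homog e l -> homog e (sdiag l).
Proof.
move=> hl; apply/mx_homogP => i j; rewrite sdiagE; case: eqP => [<-|_]; last exact: homog0.
by rewrite addbb addbF; apply: homog_twist.
Qed.

Fact mxlscaleA l m M : mxlscale l (mxlscale m M) = mxlscale (l * m) M.
Proof. by rewrite /mxlscale sdiagM mulrA. Qed.
Fact mxlscale1 M : mxlscale 1 M = M.
Proof. by rewrite /mxlscale sdiag1 mul1r. Qed.
Fact mxlscaleDr l : {morph mxlscale l : M N / M + N}.
Proof. exact: mulrDr. Qed.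
Fact mxlscaleDl M : {morph mxlscale^~ M : l m / l + m}.
Proof. by move=> l m; rewrite /mxlscale sdiagD mulrDl. Qed.
Fact mxrscaleDl l : {morph mxrscale^~ l : M N / M + N}.
Proof. by move=> M N; rewrite /mxrscale mulrDl. Qed.
Fact mxrscaleDr M : {morph mxrscale M : l m / l + m}.
Proof. by move=> l m; rewrite /mxrscale sdiagD mulrDr. Qed.
Fact mx_homogZ e f l M : homog e l -> homog f M -> homog (e (+) f) (mxlscale l M).
Proof. by move=> hl; apply/homogM/sdiag_homog. Qed.
Fact mxlscaleSC e f l M : homog e l -> homog f M ->
  mxlscale l M = (-1) ^+ (e && f) * mxrscale M l.
Proof.
move=> hl /mx_homogP hM; apply/matrixP => i j.
have -> : ((-1) ^+ (e && f) * mxrscale M l) i j = (-1) ^+ (e && f) * mxrscale M l i j.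
  by case: (e && f); rewrite ?mul1r // !mulN1r mxE.
rewrite mxlscaleE mxrscaleE !(twist_homog _ hl) -mulrA (lscale1C hl (hM i j)).
move: (lscale l 1) (M i j) => x y.
by case: (e); case: (f); case: (mxpar i); case: (mxpar j);
   rewrite /= ?mul1r ?mulN1r ?mulrN ?mulNr ?opprK.
Qed.
Fact mxlscaleAl l M N : mxlscale l (M * N) = mxlscale l M * N.
Proof. exact: mulrA. Qed.
Fact mxrscaleMl l M N : mxrscale M l * N = M * mxlscale l N.
Proof. by rewrite /mxrscale -mulrA. Qed.
Fact mxrscaleAr l M N : mxrscale (M * N) l = M * mxrscale N l.
Proof. by rewrite /mxrscale -mulrA. Qed.

HB.instance Definition _ := SuperRing_isSuperAlg.Build k (supermx A)
  mxlscaleA mxlscale1 mxlscaleDr mxlscaleDl mxrscaleDl mxrscaleDr mx_homogZ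
  mxlscaleSC mxlscaleAl mxrscaleMl mxrscaleAr.

End Actions.
End Supermatrix.

(* Main.v *)
Require Import Defs.
From HB Require Import structures.
From mathcomp Require Import all_boot.
From mathcomp Require Import ssralg matrix.
From mathcomp Require Import zify.
From mathcomp.classical Require Import boolp.

(** Write E_ij (x) a for the elementary supermatrices. Moving the matrix units to
    one side turns the supertrace into the chain map
      M_0 (x) ... (x) M_n |->
        sum_(i_0 ... i_n) (-1)^(|i_0| (1 + |M_0| + ... + |M_n|))
          M_0[i_0,i_1] (x) M_1[i_1,i_2] (x) ... (x) M_n[i_n,i_0],
    which commutes with the faces and the cyclic operator. A corner inclusion
    a |-> +-a E_oo is a section of it. In the other direction, with u_j = E_jo and
    v_j = E_oj, so that sum_j u_j v_j = 1, inserting sum_j u_j (x) v_j into a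
    chain and conjugating what precedes gives a homotopy for b between the
    identity and the composite, and a contraction for b'. Hence every column of
    the kernel of the supertrace is exact, and a zigzag started at the last
    column shows that every cycle of the kernel is a boundary. *)

Set Implicit Arguments.
Unset Strict Implicit.
Unset Printing Implicit Defensive.

Import GRing.Theory.
#[local] Open Scope ring_scope.

(** * The parity automorphism *)

Section ParityAutomorphism.

(** The obstacle is that matrix units do not commute with scalars: on a row of odd index k acts
    through its parity automorphism. Reading off an entry is therefore only semilinear, and a
    formula in the entries descends to tensors over k only if the twists of neighbouring factors
    match. They do match at the inner indices i_1, ..., i_n, and the factor (-1)^(|i_0| (|M_0| + ...
    + |M_n|)) undoes the twist left at the ends. Koszul signs are accordingly expressed by the
    automorphism [sigma b], which is (-1)^(b|x|) on homogeneous x but is additive and defined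
    everywhere; as a rule only the factor being moved then has to be homogeneous. The homotopy is
    not asked to respect the horizontal differentials. Exactness of the columns of the kernel is
    enough, because an antidiagonal meets finitely many of them, and the kernel splits off because
    the corner inclusion is a strict section commuting with all the differentials. For p = 0 every
    corner is odd, so the inclusion has to be normalised in that case too. *)

Definition sigma (V : superZmodType) (b : bool) (x : V) : V :=
  if b then hcomp false x - hcomp true x else x.

Lemma sigmaB (V : superZmodType) b : zmod_morphism (@sigma V b).
Proof. by case: b => x y //=; rewrite /sigma !raddfB /= !opprK addrACA. Qed.
HB.instance Definition _ (V : superZmodType) b :=
  GRing.isZmodMorphism.Build V V (@sigma V b) (@sigmaB V b).

Lemma sigma_homog (V : superZmodType) b e (x : V) : homog e x ->
  sigma b x = if e && b then - x else x.
Proof.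
move=> hx; case: b => /=; rewrite ?andbF //.
by rewrite /sigma !(hcomp_homog _ hx); case: e {hx}; rewrite /= ?sub0r ?subr0.
Qed.

Lemma homog_sigma (V : superZmodType) b e (x : V) : homog e x -> homog e (sigma b x).
Proof. by move=> hx; rewrite (sigma_homog _ hx); case: ifP => // _; apply: homogN. Qed.

Lemma sigma_sigma (V : superZmodType) b c (x : V) : sigma b (sigma c x) = sigma (b (+) c) x.
Proof.
rewrite -(hcomp_sum x) !raddfD /=; congr (_ + _).
  by rewrite !(sigma_homog _ (homog_sigma _ (homog_hcomp _ _))) !(sigma_homog _ (homog_hcomp _ _)).
rewrite !(sigma_homog _ (homog_sigma _ (homog_hcomp _ _))) !(sigma_homog _ (homog_hcomp _ _)) /=.
by case: b c => [] [] //; rewrite opprK.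
Qed.

Lemma sigma_homogM (R : superRingType) b e (x : R) : homog e x ->
  sigma b x = (-1) ^+ (e && b) * x.
Proof. by move=> hx; rewrite (sigma_homog _ hx); case: ifP; rewrite ?mulN1r ?mul1r. Qed.

Lemma sigmaM (R : superRingType) b : {morph @sigma R b : x y / x * y}.
Proof.
suff H e f (x y : R) : homog e x -> homog f y -> sigma b (x * y) = sigma b x * sigma b y.
  move=> x y; rewrite -(hcomp_sum x) -(hcomp_sum y) !mulrDl !mulrDr !raddfD /= !mulrDl !mulrDr.
  by rewrite !(H _ _ _ _ (homog_hcomp _ _) (homog_hcomp _ _)).
move=> hx hy; rewrite (sigma_homog _ (homogM _ _ _ _ hx hy)) (sigma_homog _ hx) (sigma_homog _ hy).
by case: b e f {hx hy} => [] [] []; rewrite /= ?mulrN ?mulNr ?opprK.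
Qed.

Lemma sigma1 (R : superRingType) b : sigma b (1 : R) = 1.
Proof. by rewrite (sigma_homog _ homog1). Qed.

Variables (k : superComRingType) (A : superAlgType k).

Lemma lscaleNr (l : k) (a : A) : lscale l (- a) = - lscale l a.
Proof. by rewrite -lscaleN1 lscaleA mulrN1 -mulN1r -lscaleA lscaleN1. Qed.

Lemma lscaleNl (l : k) (a : A) : lscale (- l) a = - lscale l a.
Proof. by rewrite -mulN1r -lscaleA lscaleN1. Qed.

Lemma sigma_lscale b (l : k) (a : A) : sigma b (lscale l a) = lscale (sigma b l) (sigma b a).
Proof.
rewrite -(hcomp_sum l) -(hcomp_sum a) !lscaleDl !lscaleDr !raddfD /= !lscaleDl !lscaleDr.
suff H e f (x : k) (y : A) : homog e x -> homog f y ->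
    sigma b (lscale x y) = lscale (sigma b x) (sigma b y).
  by rewrite !(H _ _ _ _ (homog_hcomp _ _) (homog_hcomp _ _)).
move=> hx hy; rewrite (sigma_homog _ (homogZ _ _ _ _ hx hy)) (sigma_homog _ hx) (sigma_homog _ hy).
by case: b e f {hx hy} => [] [] []; rewrite /= ?lscaleNr ?lscaleNl ?opprK.
Qed.

Lemma rscale_mulr (a : A) (l : k) : rscale a l = a * lscale l 1.
Proof. by rewrite -rscaleMl mulr1. Qed.

Lemma sigma_rscale b (l : k) (a : A) : sigma b (rscale a l) = rscale (sigma b a) (sigma b l).
Proof. by rewrite !rscale_mulr sigmaM sigma_lscale sigma1. Qed.

(** The sign for passing a scalar across [u] becomes an automorphism of the scalar, so [l] may have
    mixed parity. *)
Lemma lscale_homog d (l : k) (u : A) : homog d u -> lscale l u = rscale u (sigma d l).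
Proof.
move=> hu; rewrite -(hcomp_sum l) lscaleDl raddfD rscaleDr /=.
suff H e (m : k) : homog e m -> lscale m u = rscale u (sigma d m).
  by rewrite !(H _ _ (homog_hcomp _ _)).
move=> hm; rewrite (lscaleSC _ _ _ _ hm hu) (sigma_homog _ hm).
case: (e && d); rewrite ?mul1r // mulN1r !rscale_mulr.
by rewrite lscaleNl mulrN.
Qed.

End ParityAutomorphism.

(** * Tensors with a distinguished first or last factor *)

Lemma zmod_morphismD (U V : zmodType) (f g : U -> V) :
  zmod_morphism f -> zmod_morphism g -> zmod_morphism (fun x => f x + g x).
Proof. by move=> fB gB x y; rewrite fB gB opprD addrACA. Qed.

Lemma zmod_morphism_sum (U V : zmodType) (I : Type) (r : seq I) (P : pred I) (f : I -> U -> V) :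
  (forall i, zmod_morphism (f i)) -> zmod_morphism (fun x => \sum_(i <- r | P i) f i x).
Proof. by move=> fB x y; rewrite -sumrB; apply: eq_bigr => i _; rewrite fB. Qed.

Lemma zmod_morphism_comp (U V W : zmodType) (f : U -> V) (g : V -> W) :
  zmod_morphism f -> zmod_morphism g -> zmod_morphism (fun x => g (f x)).
Proof. by move=> fB gB x y; rewrite fB gB. Qed.

Section ChainConstructors.
Variables (k : superComRingType) (R : superAlgType k).
Local Notation tup n := {ffun 'I_n.+1 -> R}.
Local Notation chn := (@chains k R).
Local Notation tpu := (@tpure k R _).

Definition consT (T : Type) n (a : T) (t : {ffun 'I_n.+1 -> T}) : {ffun 'I_n.+2 -> T} :=
  [ffun i => if unlift ord0 i is Some j then t j else a].
Definition tailT (T : Type) n (t : {ffun 'I_n.+2 -> T}) : {ffun 'I_n.+1 -> T} :=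
  [ffun i => t (lift ord0 i)].
Definition snocT (T : Type) n (c : T) (t : {ffun 'I_n.+1 -> T}) : {ffun 'I_n.+2 -> T} :=
  [ffun i => if unlift ord_max i is Some j then t j else c].

Lemma consT0 T n (a : T) (t : {ffun 'I_n.+1 -> T}) : consT a t ord0 = a.
Proof. by rewrite ffunE unlift_none. Qed.
Lemma consTS T n (a : T) (t : {ffun 'I_n.+1 -> T}) i : consT a t (lift ord0 i) = t i.
Proof. by rewrite ffunE liftK. Qed.
Lemma snocT_max T n (c : T) (t : {ffun 'I_n.+1 -> T}) : snocT c t ord_max = c.
Proof. by rewrite ffunE unlift_none. Qed.
Lemma snocT_lift T n (c : T) (t : {ffun 'I_n.+1 -> T}) i : snocT c t (lift ord_max i) = t i.
Proof. by rewrite ffunE liftK. Qed.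

Lemma consT_eta T n (t : {ffun 'I_n.+2 -> T}) : consT (t ord0) (tailT t) = t.
Proof. by apply/ffunP => i; rewrite ffunE; case: unliftP => [j|] -> //; rewrite ffunE. Qed.

Lemma tailT_consT T n (a : T) (t : {ffun 'I_n.+1 -> T}) : tailT (consT a t) = t.
Proof. by apply/ffunP => i; rewrite ffunE consTS. Qed.

Lemma consT_upd0 T n (a x : T) (t : {ffun 'I_n.+1 -> T}) :
  upd (consT a t) ord0 x = consT x t.
Proof.
apply/ffunP => i; case: (unliftP ord0 i) => [j|] ->; last by rewrite upd_same consT0.
by rewrite upd_diff // !consTS.
Qed.

Lemma consT_upd T n (a x : T) (t : {ffun 'I_n.+1 -> T}) i :
  consT a (upd t i x) = upd (consT a t) (lift ord0 i) x.
Proof.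
apply/ffunP => j; case: (unliftP ord0 j) => [m|] ->; last by rewrite upd_diff ?consT0.
by rewrite consTS !ffunE (inj_eq lift_inj) liftK.
Qed.

Lemma tailT_upd0 T n (x : T) (t : {ffun 'I_n.+2 -> T}) : tailT (upd t ord0 x) = tailT t.
Proof. by apply/ffunP => i; rewrite !ffunE. Qed.

Lemma tailT_upd T n (x : T) (t : {ffun 'I_n.+2 -> T}) i :
  tailT (upd t (lift ord0 i) x) = upd (tailT t) i x.
Proof. by apply/ffunP => j; rewrite !ffunE (inj_eq lift_inj). Qed.

Lemma snocT_upd T n (c x : T) (t : {ffun 'I_n.+1 -> T}) i :
  snocT c (upd t i x) = upd (snocT c t) (lift ord_max i) x.
Proof.
apply/ffunP => j; case: (unliftP ord_max j) => [m|] ->.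
  by rewrite snocT_lift !ffunE (inj_eq lift_inj) liftK.
by rewrite upd_diff ?snocT_max // neq_lift.
Qed.

Lemma snocT_consT T n (a c : T) (t : {ffun 'I_n.+1 -> T}) :
  snocT c (consT a t) = consT a (snocT c t).
Proof.
apply/ffunP => i; case: (unliftP ord_max i) => [j|] ->.
  rewrite snocT_lift; case: (unliftP ord0 j) => [m|] ->.
    have -> : lift ord_max (lift ord0 m) = lift ord0 (lift ord_max m) :> 'I_n.+3.
      by apply: val_inj; rewrite /= /bump /=; lia.
    by rewrite !consTS snocT_lift.
  have -> : lift ord_max ord0 = ord0 :> 'I_n.+3 by apply: val_inj; rewrite /= /bump.
  by rewrite !consT0.
rewrite snocT_max; have -> : ord_max = lift ord0 ord_max :> 'I_n.+3 by apply: val_inj.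
by rewrite consTS snocT_max.
Qed.

Lemma chain0_tpure (t : tup 0) : tpu t = chain0 (t ord0) :> chn 0.
Proof. by congr tpure; apply/ffunP => i; rewrite ffunE (ord1 i). Qed.

Definition tlift0 (W : zmodType) (f : R -> W) : chn 0 -> W :=
  tlift (fun t : tup 0 => f (t ord0)).

Lemma tlift0_multilin (W : zmodType) (f : R -> W) :
  {morph f : x y / x + y} -> multilin (fun t : tup 0 => f (t ord0)).
Proof.
move=> fD; split=> [t i x y|t i j]; first by rewrite (ord1 i) !upd_same.
by rewrite (ord1 j).
Qed.

Lemma tlift0E (W : zmodType) (f : R -> W) a : {morph f : x y / x + y} ->
  tlift0 f (chain0 a) = f a.
Proof. by move=> fD; rewrite /tlift0 tliftE ?ffunE //; apply: tlift0_multilin. Qed.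

Lemma tlift0B (W : zmodType) (f : R -> W) : {morph f : x y / x + y} ->
  zmod_morphism (tlift0 f).
Proof. by move=> fD; apply/tliftB/tlift0_multilin. Qed.

Lemma chain0B : zmod_morphism (@chain0 k R).
Proof.
have D : {morph @chain0 k R : x y / x + y}.
  move=> x y; have E z : [ffun=> z] = upd [ffun=> x] ord0 z :> tup 0.
    by apply/ffunP => i; rewrite (ord1 i) upd_same ffunE.
  by rewrite /chain0 (E (x + y)) (E y) {2}(E x) (@tpure_multilin k R 0).1.
by move=> x y; apply/eqP; rewrite eq_sym subr_eq -D subrK.
Qed.
HB.instance Definition _ := GRing.isZmodMorphism.Build _ _ (@chain0 k R) chain0B.

Lemma scale_chain0 l (a : R) : l *: chain0 a = chain0 (lscale l a) :> chn 0.
Proof.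
rewrite /chain0 scale_tpure ffunE; congr tpure.
by apply/ffunP => i; rewrite (ord1 i) upd_same ffunE.
Qed.

Lemma chain0_ext (W : zmodType) (f g : chn 0 -> W) :
  zmod_morphism f -> zmod_morphism g ->
  (forall a, f (chain0 a) = g (chain0 a)) -> f =1 g.
Proof. by move=> fB gB fg; apply: chains_ext => // t; rewrite chain0_tpure. Qed.

Fact consT_multilin n a : multilin (fun t : tup n => tpu (consT a t) : chn n.+1).
Proof.
split=> [t i x y|t i j l ij]; rewrite !consT_upd; first exact: (@tpure_multilin k R _).1.
rewrite -{1}(consTS a t) ((@tpure_multilin k R _).2 _ _ (lift ord0 j)) ?consTS //=.
by rewrite /bump /= ij.
Qed.

Definition tcons n (a : R) : chn n -> chn n.+1 :=
  tlift (fun t : tup n => tpu (consT a t)).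

Lemma tcons_pure n a (t : tup n) : tcons a (tpu t) = tpu (consT a t).
Proof. exact/tliftE/consT_multilin. Qed.

Lemma tpure_consE n (t : tup n.+1) : tpu t = tcons (t ord0) (tpu (tailT t)).
Proof. by rewrite tcons_pure consT_eta. Qed.

Lemma tconsB n a : zmod_morphism (@tcons n a).
Proof. exact/tliftB/consT_multilin. Qed.
HB.instance Definition _ n a :=
  GRing.isZmodMorphism.Build _ _ (@tcons n a) (@tconsB n a).

Lemma tconsDl n (y : chn n) : {morph (@tcons n)^~ y : a b / a + b}.
Proof.
move=> a b; move: y; apply: chains_ext => [x y|x y|t]; rewrite ?raddfB //.
  by rewrite opprD addrACA.
rewrite !tcons_pure -(consT_upd0 0 (a + b)) (@tpure_multilin k R _).1.
by rewrite !consT_upd0.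
Qed.

Lemma tcons0l n (y : chn n) : tcons 0 y = 0.
Proof. by apply: (addIr (tcons 0 y)); rewrite -tconsDl !add0r. Qed.

Lemma tconsNl n a (y : chn n) : tcons (- a) y = - tcons a y.
Proof. by apply/eqP; rewrite -addr_eq0 -tconsDl addNr tcons0l. Qed.

Lemma tconsNr n a (y : chn n) : tcons a (- y) = - tcons a y.
Proof. exact: raddfN. Qed.

Lemma tcons_suml n (I : Type) (r : seq I) (P : pred I) (F : I -> R) (y : chn n) :
  tcons (\sum_(i <- r | P i) F i) y = \sum_(i <- r | P i) tcons (F i) y.
Proof.
by apply: (big_morph (fun a => tcons a y)) => [a b|]; [exact: tconsDl | exact: tcons0l].
Qed.

Lemma scale_tcons n l a (y : chn n) : l *: tcons a y = tcons (lscale l a) y.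
Proof.
move: y; apply: chains_ext => [x y|x y|t]; rewrite ?raddfB ?scalerBr //.
by rewrite !tcons_pure scale_tpure consT0 consT_upd0.
Qed.

Lemma tcons_rscale n l a (y : chn n) : tcons (rscale a l) y = tcons a (l *: y).
Proof.
move: y; apply: chains_ext => [x y|x y|t]; rewrite ?scalerBr ?raddfB //.
rewrite scale_tpure !tcons_pure consT_upd -(consT_upd0 a (rscale a l)).
by rewrite -{2}(consT0 a t) ((@tpure_multilin k R _).2 _ _ (lift ord0 ord0)) ?consTS.
Qed.

Lemma chains_consP n (W : zmodType) (f g : chn n.+1 -> W) :
  zmod_morphism f -> zmod_morphism g ->
  (forall a y, f (tcons a y) = g (tcons a y)) -> f =1 g.
Proof. by move=> fB gB fg; apply: chains_ext => // t; rewrite tpure_consE. Qed.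

Section ConsLift.
Variables (n : nat) (W : zmodType) (F : R -> chn n -> W).

(** The universal property of the tensor product over k of R with the next lower power. Together
    with [cliftE] it permits recursion on the number of factors, as in [htp] and [ctr]. *)
Definition clift : chn n.+1 -> W :=
  tlift (fun t : tup n.+1 => F (t ord0) (tpu (tailT t))).

Definition balanced := [/\ forall y, {morph F^~ y : a b / a + b},
  forall a, zmod_morphism (F a) & forall a l y, F (rscale a l) y = F a (l *: y)].

Hypothesis FP : balanced.

Lemma clift_multilin : multilin (fun t : tup n.+1 => F (t ord0) (tpu (tailT t))).
Proof.
have [FD FB FZ] := FP; have FDr a : {morph F a : x y / x + y}.
  move=> x y; pose G : {additive chn n -> W} := HB.pack (F a)
    (GRing.isZmodMorphism.Build _ _ (F a) (FB a)).
  exact: (raddfD G).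
split=> [t i x y|t i j l ij].
  case: (unliftP ord0 i) => [m|] ->; last by rewrite !upd_same !tailT_upd0 FD.
  by rewrite !upd_diff // !tailT_upd (@tpure_multilin k R _).1 FDr.
case: (unliftP ord0 j) ij => [j' ->|-> //] /= [ij].
rewrite [in RHS]upd_diff // [in RHS]tailT_upd.
case: (unliftP ord0 i) ij => [i' ->|->] ij.
  rewrite upd_diff // tailT_upd; congr (F _ _).
  by have := (@tpure_multilin k R n).2 (tailT t) i' j' l ij; rewrite !ffunE.
rewrite upd_same tailT_upd0 FZ scale_tpure ffunE.
by have -> : j' = ord0 by apply: val_inj.
Qed.

Lemma cliftB : zmod_morphism clift.
Proof. exact/tliftB/clift_multilin. Qed.

Lemma cliftE a y : clift (tcons a y) = F a y.
Proof.
have [_ FB _] := FP; move: y; apply: chains_ext => [x y|x y|t].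
- by rewrite raddfB cliftB.
- exact: FB.
by rewrite tcons_pure /clift tliftE ?consT0 ?tailT_consT //; apply: clift_multilin.
Qed.

End ConsLift.

Fact snocT_multilin n c : multilin (fun t : tup n => tpu (snocT c t) : chn n.+1).
Proof.
split=> [t i x y|t i j l ij]; rewrite !snocT_upd; first exact: (@tpure_multilin k R _).1.
rewrite -{1}(snocT_lift c t) ((@tpure_multilin k R _).2 _ _ (lift ord_max j)) ?snocT_lift //=.
by have := ltn_ord i; have := ltn_ord j; rewrite /bump /=; lia.
Qed.

Definition tsnoc n (c : R) : chn n -> chn n.+1 :=
  tlift (fun t : tup n => tpu (snocT c t)).

Lemma tsnoc_pure n c (t : tup n) : tsnoc c (tpu t) = tpu (snocT c t).
Proof. exact/tliftE/snocT_multilin. Qed.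

Lemma tsnocB n c : zmod_morphism (@tsnoc n c).
Proof. exact/tliftB/snocT_multilin. Qed.
HB.instance Definition _ n a :=
  GRing.isZmodMorphism.Build _ _ (@tsnoc n a) (@tsnocB n a).

Lemma tsnoc_cons n a c (y : chn n) : tsnoc c (tcons a y) = tcons a (tsnoc c y).
Proof.
move: y; apply: chains_ext => [x y|x y|t]; rewrite ?raddfB //.
by rewrite tsnoc_pure !tcons_pure tsnoc_pure snocT_consT.
Qed.

Lemma tsnoc_chain0 a c : tsnoc c (chain0 a) = tcons a (chain0 c) :> chn 1.
Proof.
rewrite /chain0 tsnoc_pure tcons_pure; congr tpure; apply/ffunP => i.
case: (unliftP ord0 i) => [j|] ->; rewrite ?consT0 ?consTS ffunE.
  rewrite (ord1 j); have -> : lift ord0 ord0 = ord_max :> 'I_2 by apply: val_inj.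
  by rewrite unlift_none ffunE.
have -> : ord0 = lift ord_max ord0 :> 'I_2 by apply: val_inj.
by rewrite liftK ffunE.
Qed.

Lemma tsnocDl n (y : chn n) : {morph (@tsnoc n)^~ y : a b / a + b}.
Proof.
elim: n y => [|n IH] y a b; move: y; [apply: chain0_ext|apply: chains_consP].
- exact: tsnocB.
- exact/zmod_morphismD/tsnocB/tsnocB.
- by move=> c; rewrite !tsnoc_chain0 raddfD raddfD.
- exact: tsnocB.
- exact/zmod_morphismD/tsnocB/tsnocB.
by move=> c y; rewrite !tsnoc_cons IH raddfD.
Qed.

(** Extensionality from the right end. Parity is asked of the last factor alone, since the signs of
    the last face and of [cyct] depend on the other factors only through their total parity, which
    [csigma] handles. *)
Lemma chains_snocP n (W : zmodType) (f g : chn n.+1 -> W) :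
  zmod_morphism f -> zmod_morphism g ->
  (forall e c x, homog e c -> f (tsnoc c x) = g (tsnoc c x)) -> f =1 g.
Proof.
move=> fB gB fg; pose F : {additive chn n.+1 -> W} := HB.pack f
    (GRing.isZmodMorphism.Build _ _ f fB).
pose G : {additive chn n.+1 -> W} := HB.pack g (GRing.isZmodMorphism.Build _ _ g gB).
apply: chains_ext => // t; rewrite -[f]/(F : _ -> _) -[g]/(G : _ -> _).
have -> : tpu t = tsnoc (t ord_max) (tpu [ffun i => t (lift ord_max i)]).
  rewrite tsnoc_pure; congr tpure; apply/ffunP => i.
  by case: (unliftP ord_max i) => [j|] ->; rewrite ?snocT_max ?snocT_lift ?ffunE.
rewrite -(hcomp_sum (t ord_max)) tsnocDl !raddfD /=.
by rewrite !(fg _ _ _ (homog_hcomp _ _)).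
Qed.

End ChainConstructors.

(** * Maps of tensor powers induced by a semilinear map *)

Section ChainMap.
Variables (k : superComRingType) (R R' : superAlgType k).
Variables (theta : k -> k) (f : R -> R').
Local Notation tup n := {ffun 'I_n.+1 -> R}.

Definition tmap n : chains R n -> chains R' n :=
  tlift (fun t : tup n => tpure [ffun i => f (t i)]).

(** The twist [theta] is there because neither the parity automorphism nor the inclusion of an odd
    corner is k-linear. *)
Definition semialgebraic := [/\ {morph f : x y / x + y},
  forall l a, f (lscale l a) = lscale (theta l) (f a) &
  forall a l, f (rscale a l) = rscale (f a) (theta l)].

Hypothesis fP : semialgebraic.

Lemma tmap_multilin n : multilin (fun t : tup n => tpure [ffun i => f (t i)] : chains R' n).
Proof.
have [fD fl fr] := fP.
have E (t : tup n) i x : [ffun j => f (upd t i x j)] = upd [ffun j => f (t j)] i (f x).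
  by apply/ffunP => j; rewrite !ffunE; case: eqP.
split=> [t i x y|t i j l ij]; rewrite !E; first by rewrite fD (@tpure_multilin k R' n).1.
rewrite fr fl; have := (@tpure_multilin k R' n).2 [ffun j => f (t j)] i j (theta l) ij.
by rewrite !ffunE.
Qed.

Lemma tmap_pure n (t : tup n) : tmap (tpure t) = tpure [ffun i => f (t i)].
Proof. exact/tliftE/tmap_multilin. Qed.

Lemma tmapB n : zmod_morphism (@tmap n).
Proof. exact/tliftB/tmap_multilin. Qed.

Lemma tmap_chain0 a : tmap (chain0 a) = chain0 (f a).
Proof. by rewrite tmap_pure; congr tpure; apply/ffunP => i; rewrite !ffunE. Qed.

Lemma tmap_cons n a (y : chains R n) : tmap (tcons a y) = tcons (f a) (tmap y).
Proof.
move: y; apply: chains_ext => [||t].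
- exact: zmod_morphism_comp (tconsB a) (@tmapB n.+1).
- exact: zmod_morphism_comp (@tmapB n) (tconsB (f a)).
rewrite tcons_pure !tmap_pure tcons_pure; congr tpure; apply/ffunP => i.
by rewrite !ffunE; case: unliftP => // j _; rewrite ffunE.
Qed.

Lemma tmap_snoc n c (y : chains R n) : tmap (tsnoc c y) = tsnoc (f c) (tmap y).
Proof.
move: y; apply: chains_ext => [||t].
- exact: zmod_morphism_comp (tsnocB c) (@tmapB n.+1).
- exact: zmod_morphism_comp (@tmapB n) (tsnocB (f c)).
rewrite tsnoc_pure !tmap_pure tsnoc_pure; congr tpure; apply/ffunP => i.
by rewrite !ffunE; case: unliftP => // j _; rewrite ffunE.
Qed.

Lemma tmapZ n l (x : chains R n) : tmap (l *: x) = theta l *: tmap x.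
Proof.
have [_ fl _] := fP; move: x; apply: chains_ext => [||t].
- by move=> x y; rewrite scalerBr tmapB.
- by move=> x y; rewrite tmapB scalerBr.
rewrite scale_tpure !tmap_pure scale_tpure; congr tpure; apply/ffunP => i.
by rewrite !ffunE; case: eqP => //; rewrite fl.
Qed.

End ChainMap.

(** * Multiplication into the first factor, and the faces in terms of it *)

Section LeftMultiplication.
Variables (k : superComRingType) (R : superAlgType k).

Definition tlmul n (a : R) : chains R n -> chains R n :=
  match n with
  | 0 => tlift0 (fun b => chain0 (a * b))
  | n.+1 => clift (fun b y => tcons (a * b) y)
  end.

Lemma tlmul_balanced n a : balanced (fun b (y : chains R n) => tcons (a * b) y).
Proof.
split=> [y b c|b|b l y]; first by rewrite mulrDr tconsDl.
  exact: tconsB.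
by rewrite -rscaleAr tcons_rscale.
Qed.

Lemma tlmul_chain0 a b : tlmul a (chain0 b : chains R 0) = chain0 (a * b).
Proof. by rewrite /tlmul tlift0E // => x y; rewrite mulrDr raddfD. Qed.

Lemma tlmul_cons n a b (y : chains R n) : tlmul a (tcons b y) = tcons (a * b) y.
Proof. exact/cliftE/tlmul_balanced. Qed.

Lemma tlmulB n a : zmod_morphism (@tlmul n a).
Proof.
case: n => [|n]; last exact/cliftB/tlmul_balanced.
by apply: tlift0B => x y; rewrite mulrDr raddfD.
Qed.
HB.instance Definition _ n a :=
  GRing.isZmodMorphism.Build _ _ (@tlmul n a) (@tlmulB n a).

Lemma tlmul_pure n a (t : {ffun 'I_n.+1 -> R}) :
  tlmul a (tpure t) = tpure (upd t ord0 (a * t ord0)).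
Proof.
case: n t => [|n] t.
  rewrite !chain0_tpure tlmul_chain0; congr chain0.
  by rewrite upd_same.
rewrite !tpure_consE tlmul_cons upd_same; congr tcons; congr tpure.
by rewrite tailT_upd0.
Qed.

Lemma tlmulDl n (x : chains R n) : {morph (@tlmul n)^~ x : a b / a + b}.
Proof.
move=> a b; move: x; apply: chains_ext => [||t].
- exact: tlmulB.
- exact/zmod_morphismD/tlmulB/tlmulB.
by rewrite !tlmul_pure mulrDl (@tpure_multilin k R n).1.
Qed.

Lemma tlmul_suml n (I : Type) (r : seq I) (P : pred I) (F : I -> R) (x : chains R n) :
  tlmul (\sum_(i <- r | P i) F i) x = \sum_(i <- r | P i) tlmul (F i) x.
Proof.
apply: (big_morph (fun a => tlmul a x)) => [a b|]; first exact: tlmulDl.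
by apply: (addIr (tlmul 0 x)); rewrite -tlmulDl !add0r.
Qed.

Lemma tlmulM n a b (x : chains R n) : tlmul a (tlmul b x) = tlmul (a * b) x.
Proof.
move: x; apply: chains_ext => [||t].
- exact: zmod_morphism_comp (tlmulB b) (tlmulB a).
- exact: tlmulB.
by rewrite !tlmul_pure upd_same upd_upd mulrA.
Qed.

Lemma scale_tlmul n l a (x : chains R n) : l *: tlmul a x = tlmul (lscale l a) x.
Proof.
move: x; apply: chains_ext => [||t]; last 1 first.
- by rewrite !tlmul_pure scale_tpure upd_same upd_upd lscaleAl.
- by move=> x y; rewrite tlmulB scalerBr.
exact: tlmulB.
Qed.

Lemma tlmul_rscale n l a (x : chains R n) : tlmul (rscale a l) x = tlmul a (l *: x).
Proof.
move: x; apply: chains_ext => [||t]; last 1 first.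
- by rewrite scale_tpure !tlmul_pure upd_same upd_upd rscaleMl.
- exact: tlmulB.
by move=> x y; rewrite scalerBr tlmulB.
Qed.

Lemma tlmul_snoc n a c (x : chains R n) : tlmul a (tsnoc c x) = tsnoc c (tlmul a x).
Proof.
case: n x => [|n]; [apply: chain0_ext|apply: chains_consP];
  try exact: zmod_morphism_comp (tlmulB a) (tsnocB c);
  try exact: zmod_morphism_comp (tsnocB c) (tlmulB a).
  by move=> b; rewrite tlmul_chain0 !tsnoc_chain0 tlmul_cons.
by move=> b y; rewrite tlmul_cons !tsnoc_cons tlmul_cons.
Qed.

Lemma consT_inord n (a : R) (t : {ffun 'I_n.+1 -> R}) m : (m <= n)%N ->
  consT a t (inord m.+1) = t (inord m).
Proof.
move=> mn; have -> : inord m.+1 = lift ord0 (inord m) :> 'I_n.+2.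
  by apply: val_inj; rewrite /= /bump !inordK.
by rewrite consTS.
Qed.

Lemma face0_cons n a (y : chains R n) : face 0 (tcons a y) = tlmul a y.
Proof.
move: y; apply: chains_ext => [||t].
- exact: zmod_morphism_comp (tconsB a) (raddfB (face 0)).
- exact: tlmulB.
rewrite tcons_pure tlmul_pure /face /= tliftE; last exact: mergeT_multilin.
have E m : inord 0 = ord0 :> 'I_m.+1 by apply: val_inj; rewrite /= inordK.
congr tpure; apply/ffunP => j; rewrite [LHS]ffunE [RHS]ffunE /= !E consT0.
rewrite !consT_inord ?E ?inord_val // -1?ltnS //.
Qed.

(** With [face0_cons] this computes every face except the last by recursion on the first factor. *)
Lemma faceS_cons n i a (y : chains R n.+1) : (i <= n)%N ->
  face i.+1 (tcons a y) = tcons a (face i y).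
Proof.
move=> lin; move: y; apply: chains_ext => [||t].
- exact: zmod_morphism_comp (tconsB a) (raddfB (face i.+1)).
- exact: zmod_morphism_comp (raddfB (face i)) (tconsB a).
rewrite tcons_pure /face ltnS lin.
rewrite !tliftE ?tcons_pure; [|exact: mergeT_multilin..].
congr tpure; apply/ffunP => j; case: (unliftP ord0 j) => [m|] ->.
  rewrite consTS [LHS]ffunE [RHS]ffunE /= /bump /= !add1n ltnS eqSS.
  have mn : (m < n.+1)%N := ltn_ord m.
  by rewrite !consT_inord // leqW.
rewrite consT0 ffunE /=.
have -> : inord 0 = ord0 :> 'I_n.+3 by apply: val_inj; rewrite /= inordK.
by rewrite consT0.
Qed.

End LeftMultiplication.
Arguments tlmul : simpl never.

Lemma tmap_lmul (k : superComRingType) (R R' : superAlgType k) theta (f : R -> R') n a (x : chains R n) :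
  semialgebraic theta f -> {morph f : x y / x * y} ->
  tmap f (tlmul a x) = tlmul (f a) (tmap f x).
Proof.
move=> fP fM; move: x; apply: chains_ext => [||t].
- exact: zmod_morphism_comp (tlmulB a) (@tmapB _ _ _ _ _ fP n).
- exact: zmod_morphism_comp (@tmapB _ _ _ _ _ fP n) (tlmulB (f a)).
rewrite tlmul_pure !(tmap_pure fP) tlmul_pure; congr tpure; apply/ffunP => i.
by rewrite !ffunE; case: eqP => // ->; rewrite fM.
Qed.

(* Applied to a i j = (-1)^i d_i t^j, where the second hypothesis is
   d_0 t = (-1)^(n+1) d_(n+1); it then reads N b = b' N. *)
Lemma sum_cyclic_orbits (V : zmodType) (t : {additive V -> V}) (a : nat -> nat -> V) n :
  (forall i j, (i <= n)%N -> t (a i j) = a i.+1 j.+1) ->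
  (forall j, a n.+1 j = a 0 j.+1) ->
  \sum_(s < n.+1) iter s t (\sum_(i < n.+2) a i 0) = \sum_(j < n.+2) \sum_(i < n.+1) a i j.
Proof.
move=> ta a0.
(* Each application of t moves a term one step down the diagonal, and a term reaching row n + 1
   re-enters at row 0 of the next column. Column j then receives its rows i >= j from s = j and its
   rows i < j from s = j - 1. *)
have H s : (s <= n)%N -> iter s t (\sum_(i < n.+2) a i 0) =
    \sum_(s <= i < n.+1) a i s + \sum_(0 <= i < s.+1) a i s.+1.
  elim: s => [|s IH] sn.
    by rewrite big_nat1 big_mkord big_ord_recr /= a0.
  rewrite iterS IH 1?ltnW // raddfD !raddf_sum /=.
  rewrite [X in _ = _ + X]big_nat_recl // -a0 addrA; congr (_ + _); last first.
    by apply: eq_big_nat => i /andP[_ iS]; rewrite ta // (leq_trans _ sn) // ltnW.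
  rewrite -big_nat_recr ?leqW //= big_add1 /=; apply: eq_big_nat => i /andP[_ iS].
  by rewrite ta.
under eq_bigr => s _ do rewrite H -1?ltnS //.
rewrite big_split /=.
under [RHS]eq_bigr => j _.
  rewrite -(big_mkord xpredT (a^~ j)) (@big_cat_nat _ _ _ j) -1?ltnS //=.
  over.
rewrite big_split /= addrC; congr (_ + _).
  by rewrite [RHS]big_ord_recl big_geq ?add0r.
by rewrite [RHS]big_ord_recr /= [X in _ = _ + X]big_geq ?addr0.
Qed.

(** * The parity automorphism on chains and the cyclic operator *)

Section CyclicRelations.
Variables (k : superComRingType) (R : superAlgType k).

Lemma sigma_semialgebraic b : semialgebraic (@sigma k b) (@sigma R b).
Proof. by split=> [x y|l a|a l]; rewrite ?raddfD ?sigma_lscale ?sigma_rscale. Qed.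

(** On homogeneous tensors this is multiplication by (-1)^(b (|a_0| + ... + |a_n|)), see
    [csigma_homogs]: the Koszul sign for carrying a factor of parity b past the whole chain. *)
Definition csigma n (b : bool) : chains R n -> chains R n := @tmap k R R (@sigma R b) n.

Lemma csigmaB n b : zmod_morphism (@csigma n b).
Proof. exact/tmapB/sigma_semialgebraic. Qed.
HB.instance Definition _ n b :=
  GRing.isZmodMorphism.Build _ _ (@csigma n b) (@csigmaB n b).

Lemma csigma_chain0 b (a : R) : csigma b (chain0 a) = chain0 (sigma b a).
Proof. exact/tmap_chain0/sigma_semialgebraic. Qed.
Lemma csigma_cons n b a (y : chains R n) : csigma b (tcons a y) = tcons (sigma b a) (csigma b y).
Proof. exact/tmap_cons/sigma_semialgebraic. Qed.
Lemma csigma_snoc n b c (y : chains R n) : csigma b (tsnoc c y) = tsnoc (sigma b c) (csigma b y).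
Proof. exact/tmap_snoc/sigma_semialgebraic. Qed.
Lemma csigmaZ n b l (x : chains R n) : csigma b (l *: x) = sigma b l *: csigma b x.
Proof. exact/tmapZ/sigma_semialgebraic. Qed.
Lemma csigma_lmul n b a (x : chains R n) : csigma b (tlmul a x) = tlmul (sigma b a) (csigma b x).
Proof. by apply: tmap_lmul; [exact: sigma_semialgebraic | exact: sigmaM]. Qed.

Lemma csigma_csigma n b c (x : chains R n) : csigma b (csigma c x) = csigma (b (+) c) x.
Proof.
move: x; apply: chains_ext => [||t].
- exact: zmod_morphism_comp (csigmaB c) (csigmaB b).
- exact: csigmaB.
rewrite /csigma !(tmap_pure (sigma_semialgebraic _)); congr tpure; apply/ffunP => i.
by rewrite !ffunE sigma_sigma.
Qed.

Lemma csigma_false n (x : chains R n) : csigma false x = x.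
Proof.
move: x; apply: chains_ext => [||t]; [exact: csigmaB | by [] |].
rewrite /csigma (tmap_pure (sigma_semialgebraic _)); congr tpure; apply/ffunP => i.
by rewrite ffunE.
Qed.

Lemma csigma_homogs n b e (t : {ffun 'I_n.+1 -> R}) : homogs e t ->
  csigma b (tpure t) = (-1) ^+ (b * \sum_(i < n.+1) e i) *: tpure t.
Proof.
have sgn d m a (y : chains R m) : homog d a ->
    tcons (sigma b a) y = (-1) ^+ (b * d) *: tcons a y.
  move=> ha; rewrite (sigma_homog _ ha); case: b d ha => [] [] _;
    by rewrite /= ?scale1r // tconsNl scaleN1r.
elim: n e t => [|n IH] e t ht.
  have -> : tpure t = chain0 (t ord0) by exact: chain0_tpure.
  rewrite csigma_chain0 big_ord1 (sigma_homog _ (ht _)).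
  by case: (b) (e _) => [] []; rewrite /= ?scale1r // raddfN scaleN1r.
rewrite tpure_consE csigma_cons (sgn _ _ _ _ (ht _)) big_ord_recl mulnDr exprD -scalerA.
congr (_ *: _); rewrite (IH (tailT e)); last by move=> i; rewrite !ffunE.
rewrite raddfZsign /=; congr ((-1) ^+ (_ * _) *: _).
by apply: eq_bigr => i _; rewrite ffunE.
Qed.

Lemma cyct_multiadd n (e : {ffun 'I_n.+1 -> bool}) :
  multiadd (fun a : {ffun 'I_n.+1 -> R} => (-1) ^+ (n + koszul e) *: tpure (rotT a)).
Proof.
apply: multiadd_comp => [x y|a i x y]; first by rewrite scalerBr.
have [->|ni] := eqVneq i ord_max; first by rewrite !rotT_upd_max (@tpure_multilin k R n).1.
have lin : (i < n)%N by rewrite ltn_neqAle -ltnS ltn_ord andbT.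
by rewrite -[i]inord_val !rotT_updS // (@tpure_multilin k R n).1.
Qed.

Lemma cyct_chain0 (x : chains R 0) : cyct x = x.
Proof.
move: x; apply: chain0_ext => [||a]; [exact: raddfB|by []|].
rewrite -(hcomp_sum a) !raddfD /=.
suff H e (b : R) : homog e b -> cyct (chain0 b) = chain0 b :> chains R 0.
  by rewrite !(H _ _ (homog_hcomp _ _)).
move=> hb; rewrite {1}/chain0 cyctE (@hsumE _ _ _ _ _ [ffun=> e]).
- rewrite /koszul big_ord0 muln0 scale1r /chain0; congr tpure.
  by apply/ffunP => i; rewrite !ffunE; case: ifP.
- exact: (@cyct_multiadd 0).
by move=> i; rewrite !ffunE.
Qed.

Lemma rotT_snocT (T : Type) n (c : T) (t : {ffun 'I_n.+1 -> T}) :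
  rotT (snocT c t) = consT c t.
Proof.
apply/ffunP => i; case: (unliftP ord0 i) => [j|] ->; rewrite ?consT0 ?consTS ffunE /=.
  rewrite /bump /= -(snocT_lift c t); congr (snocT c t _).
  by apply: val_inj; rewrite [RHS]lift_max /= inordK //; apply: leqW (ltn_ord j).
exact: snocT_max.
Qed.

Lemma koszul_snocT n d (e : {ffun 'I_n.+1 -> bool}) :
  koszul (snocT d e) = (d * \sum_(i < n.+1) e i)%N.
Proof.
rewrite /koszul snocT_max; congr (_ * _)%N; apply: eq_bigr => i _.
rewrite -(snocT_lift d e); congr (nat_of_bool (snocT d e _)); apply: val_inj.
by rewrite [RHS]lift_max /= inordK //; apply: leqW (ltn_ord i).
Qed.

(** The sign of the rotation depends on x only through its total parity, so [csigma e] produces it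
    without splitting x into homogeneous parts. *)
Lemma cyct_snoc n e c (x : chains R n) : homog e c ->
  cyct (tsnoc c x) = (-1) ^+ n.+1 *: tcons c (csigma e x).
Proof.
move=> hc; move: x; apply: chains_ext => [||t].
- exact: zmod_morphism_comp (tsnocB c) (raddfB (@cyct k R n.+1)).
- by move=> x y; rewrite !raddfB.
rewrite tsnoc_pure; move: t; apply: multiadd_ext.
- apply: (@multiadd_comp _ _ _ _ _ (fun t => tpure (snocT c t)) (@cyct k R n.+1)).
    exact: raddfB.
  exact: (@snocT_multilin k R n c).1.
- pose g (x : chains R n) := (-1) ^+ n.+1 *: tcons c (csigma e x).
  apply: (@multiadd_comp _ _ _ _ _ (@tpure k R n) g); last exact: (@tpure_multilin k R n).1.
  by move=> x y; rewrite /g !raddfB.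
move=> d t ht; rewrite (csigma_homogs _ ht) raddfZsign /= scalerA -exprD tcons_pure.
rewrite cyctE (hsumE (@cyct_multiadd n.+1) (e := snocT e d)).
  by rewrite rotT_snocT koszul_snocT.
by move=> i; case: (unliftP ord_max i) => [j|] ->; rewrite ?snocT_max ?snocT_lift.
Qed.

(** A linear map commuting with d_0 and with t thus commutes with the last face as well. *)
Lemma face_max n (x : chains R n.+1) : face n.+1 x = (-1) ^+ n.+1 *: face 0 (cyct x).
Proof.
move: x; apply: chains_ext => [||t]; [exact: raddfB|by move=> x y; rewrite !raddfB|].
have E : (fun a : {ffun 'I_n.+2 -> R} => \sum_e
   (-1) ^+ koszul e *: tpure (wrapT [ffun i => hcomp (e i) (a i)]) : chains R n)
   =1 (fun a => (-1) ^+ n.+1 *: face 0 (cyct (tpure a))).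
  move=> a; rewrite cyctE /hsum raddf_sum scaler_sumr; apply: eq_bigr => e _ /=.
  rewrite linearZ /= scalerA exprD mulrA -expr2 sqrr_sign mul1r wrapTE.
  by rewrite /face /= tliftE //; apply: mergeT_multilin.
rewrite [LHS]/face ltnn tliftE; first exact: E.
apply: (eq_multilin (fsym E)).
apply: (multilin_comp (g := fun x => (-1) ^+ n.+1 *: face 0 (cyct x))) => [x y|].
  by rewrite !raddfB.
exact: tpure_multilin.
Qed.
End CyclicRelations.

(** * Relations between faces and the cyclic operator *)

Section FaceRelations.
Variables (k : superComRingType) (R : superAlgType k).
Local Notation chn := (@chains k R).

Lemma faceB n i : zmod_morphism (@face k R n i). Proof. exact: raddfB. Qed.
Lemma cyctB n : zmod_morphism (@cyct k R n). Proof. exact: raddfB. Qed.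

Lemma face_snoc n i c (y : chn n.+1) : (i <= n)%N ->
  face i (tsnoc c y) = tsnoc c (face i y).
Proof.
elim: n i y => [|n IH] i y lin; move: y; apply: chains_consP.
1,4: by move=> u v; rewrite tsnocB faceB.
1,3: by move=> u v; rewrite faceB tsnocB.
- case: i lin => // _ a y.
  by rewrite tsnoc_cons !face0_cons tlmul_snoc.
- case: i lin => [|i] lin a y; first by rewrite tsnoc_cons !face0_cons tlmul_snoc.
  by rewrite tsnoc_cons faceS_cons 1?ltnW // IH // faceS_cons // tsnoc_cons.
Qed.

Lemma face_csigma n i b (x : chn n.+1) : (i <= n)%N ->
  face i (csigma b x) = csigma b (face i x).
Proof.
elim: n i x => [|n IH] i x lin; move: x; apply: chains_consP.
1,4: by move=> u v; rewrite csigmaB faceB.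
1,3: by move=> u v; rewrite faceB csigmaB.
- case: i lin => // _ a y.
  by rewrite csigma_cons !face0_cons csigma_lmul.
- case: i lin => [|i] lin a y; first by rewrite csigma_cons !face0_cons csigma_lmul.
  by rewrite csigma_cons !faceS_cons // IH // csigma_cons.
Qed.

Lemma face_max_snoc n e c (x : chn n) : homog e c ->
  face n.+1 (tsnoc c x) = tlmul c (csigma e x).
Proof.
move=> hc; rewrite face_max (cyct_snoc _ hc) linearZ /= scalerA -expr2 sqrr_sign scale1r.
exact: face0_cons.
Qed.

(** Both automorphisms contribute (-1)^(ef), so the signs cancel. This compares rotating c and then
    b with rotating the product b c at once. *)
Lemma mul_sigma e f (b c : R) : homog e c -> homog f b -> sigma e b * sigma f c = b * c.
Proof.
move=> hc hb; rewrite (sigma_homog _ hb) (sigma_homog _ hc) andbC.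
by case: ifP; rewrite ?mulrN ?mulNr ?opprK.
Qed.

Lemma faceS_cyct n i (x : chn n.+1) : (i <= n)%N ->
  face i.+1 (cyct x) = - cyct (face i x).
Proof.
move=> lin; move: x; apply: chains_snocP.
- exact: zmod_morphism_comp (@cyctB n.+1) (@faceB _ i.+1).
- move=> x y; rewrite faceB cyctB.
  by rewrite opprB opprK addrC.
move=> e c x hc; rewrite (cyct_snoc _ hc) linearZ /=.
(* For i < n the face leaves the last factor alone. For i = n it multiplies the last two, which the
   other side rotates one after the other. *)
have [ltin|lein] := ltnP i n.
  case: n x lin ltin => // n x _ lin; rewrite faceS_cons // face_snoc // (cyct_snoc _ hc).
  by rewrite [in RHS]exprS mulN1r scaleNr opprK face_csigma // exprS exprS mulN1r mulN1r opprK.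
have {lein lin} -> : i = n by apply/eqP; rewrite eqn_leq lin.
rewrite exprS mulN1r scaleNr; congr (- _).
case: n x => [|n]; [apply: chain0_ext|apply: chains_snocP].
- by move=> x y; rewrite csigmaB tconsB faceB scalerBr.
- exact: zmod_morphism_comp (tsnocB c) (zmod_morphism_comp (@faceB _ 0) (@cyctB 0)).
- move=> b; rewrite -(hcomp_sum b) !raddfD /=.
  suff H f (a : R) : homog f a -> (-1) ^+ 0 *: face 1 (tcons c (csigma e (chain0 a))) =
      cyct (face 0 (tsnoc c (chain0 a))) :> chn 0.
    by rewrite !(H _ _ (homog_hcomp _ _)).
  move=> ha; rewrite scale1r csigma_chain0 -tsnoc_chain0.
  rewrite (face_max_snoc _ (homog_sigma _ ha)) csigma_chain0 tlmul_chain0 mul_sigma //.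
  by rewrite tsnoc_chain0 face0_cons tlmul_chain0 cyct_chain0.
- by move=> x y; rewrite csigmaB tconsB faceB scalerBr.
- exact: zmod_morphism_comp (tsnocB c) (zmod_morphism_comp (@faceB _ _) (@cyctB _)).
move=> f b x hb; rewrite csigma_snoc -tsnoc_cons (face_max_snoc _ (homog_sigma _ hb)).
rewrite csigma_cons tlmul_cons mul_sigma // csigma_csigma.
have -> : face n.+1 (tsnoc c (tsnoc b x)) = tsnoc (b * c) x.
  move: {hb} x; elim: n => [|n IH]; [apply: chain0_ext|apply: chains_consP].
  - exact: zmod_morphism_comp (tsnocB b) (zmod_morphism_comp (tsnocB c) (@faceB _ _)).
  - exact: tsnocB.
  - move=> a; rewrite !tsnoc_chain0 tsnoc_cons tsnoc_chain0 faceS_cons //.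
    by rewrite face0_cons tlmul_chain0.
  - exact: zmod_morphism_comp (tsnocB b) (zmod_morphism_comp (tsnocB c) (@faceB _ _)).
  - exact: tsnocB.
  by move=> a x; rewrite !tsnoc_cons faceS_cons // IH.
by rewrite (cyct_snoc _ (homogM _ _ _ _ hb hc)) addbC.
Qed.

Lemma bdiffE n (x : chn n.+1) : bdiff x = bdiff' x + (-1) ^+ n.+1 *: face n.+1 x.
Proof. by rewrite /bdiff big_ord_recr. Qed.

Lemma face_max_cyct n (x : chn n.+1) : (-1) ^+ n.+1 *: face n.+1 x = face 0 (cyct x).
Proof. by rewrite face_max scalerA -expr2 sqrr_sign scale1r. Qed.

(** Since (-1)^(n+1) d_(n+1) = d_0 t, one has b = b' + d_0 t, and d_(i+1) t = - t d_i gives b t =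
    d_0 t + t b'. The terms d_0 t cancel. *)
Lemma bdiff_cycT n (x : chn n.+1) : bdiff (cycT x) = cycT (bdiff' x).
Proof.
have H : bdiff (cyct x) = face 0 (cyct x) + cyct (bdiff' x).
  rewrite /bdiff big_ord_recl /= scale1r; congr (_ + _).
  rewrite /bdiff' raddf_sum; apply: eq_bigr => i _ /=.
  rewrite faceS_cyct -1?ltnS //= linearZ /= /bump /= add1n exprS mulN1r scaleNr scalerN.
  by rewrite opprK.
by rewrite /cycT raddfB /= H bdiffE face_max_cyct opprD addrA addrK.
Qed.

Lemma cycN_bdiff n (x : chn n.+1) : cycN (bdiff x) = bdiff' (cycN x).
Proof.
rewrite /cycN raddf_sum.
apply: (sum_cyclic_orbits (t := @cyct k R n)
  (a := fun i j => (-1) ^+ i *: face i (iter j (@cyct k R n.+1) x))).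
  move=> i j lin /=; rewrite linearZ /= faceS_cyct // exprS mulN1r scaleNr scalerN.
  by rewrite opprK.
by move=> j; rewrite face_max_cyct scale1r.
Qed.

Lemma CC_square i j (x : chn j.+1) :
  CC_vdiff R i j (CC_hdiff R i j.+1 x) = CC_hdiff R i j (CC_vdiff R i.+1 j x).
Proof.
rewrite /CC_vdiff /CC_hdiff /=; case: (odd i) => /=; first by rewrite cycN_bdiff.
exact: bdiff_cycT.
Qed.

Lemma bdiff'_cons n a (y : chn n.+1) :
  bdiff' (tcons a y) = tlmul a y - tcons a (bdiff' y).
Proof.
rewrite /bdiff' big_ord_recl /= scale1r face0_cons raddf_sum -sumrN; congr (_ + _).
apply: eq_bigr => i _; rewrite /= /bump /= add1n faceS_cons -1?ltnS //.
by rewrite raddfZsign exprS mulN1r scaleNr.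
Qed.

Lemma bdiff'_cons0 a (y : chn 0) : bdiff' (tcons a y) = tlmul a y.
Proof. by rewrite /bdiff' big_ord1 scale1r face0_cons. Qed.

End FaceRelations.

(** * The homotopy attached to a decomposition of 1 *)

Section Homotopy.
Variables (k : superComRingType) (R : superAlgType k).
Variables (J : finType) (d : J -> bool) (u v : J -> R).
Hypothesis uh : forall j, homog (d j) (u j).
Hypothesis vh : forall j, homog (d j) (v j).
Hypothesis uv1 : \sum_j u j * v j = 1.
Local Notation chn := (@chains k R).

Lemma bdiff'B n : zmod_morphism (@bdiff' k R n). Proof. exact: raddfB. Qed.

(* The alternating sum over i of
   a_0 u (x) v a_1 u (x) ... (x) v a_i u (x) v (x) a_(i+1) (x) ... (x) a_n,
   with one summation index for each adjacent pair u, v. *)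
Fixpoint htp n : chn n -> chn n.+1 :=
  match n with
  | 0 => tlift0 (fun a => \sum_j tcons (a * u j) (chain0 (v j)))
  | n.+1 => clift (fun a y =>
      \sum_j tcons (a * u j) (tcons (v j) y - @htp n (tlmul (v j) y)))
  end.

(* a_0 u (x) v a_1 u (x) ... (x) v a_n u_m, only the last index being free. *)
Fixpoint tconj m n : chn n -> chn n :=
  match n with
  | 0 => tlift0 (fun a => chain0 (a * u m))
  | n.+1 => clift (fun a y => \sum_j tcons (a * u j) (@tconj m n (tlmul (v j) y)))
  end.

Arguments htp : simpl never.
Arguments tconj : simpl never.

Section Insertion.
Variables (n n' : nat) (G : J -> chn n -> chn n').
Hypothesis GB : forall j, zmod_morphism (G j).
Hypothesis GZ : forall j l y, G j (l *: y) = sigma (d j) l *: G j y.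

(** A scalar passing u_j is twisted by [sigma (d j)], and [GZ] provides the same twist on the other
    side because v_j has the parity of u_j. So the insertion of u_j (x) v_j is well defined over k
    even when the u_j are odd. *)
Lemma insertion_balanced : balanced (fun a y => \sum_j tcons (a * u j) (G j y)).
Proof.
split=> [y a b|a|a l y].
- by rewrite -big_split; apply: eq_bigr => j _; rewrite mulrDl tconsDl.
- by apply: zmod_morphism_sum => j; apply: zmod_morphism_comp (GB j) (tconsB _).
apply: eq_bigr => j _; rewrite rscaleMl (lscale_homog _ (uh j)) -rscaleAr.
by rewrite tcons_rscale GZ.
Qed.

Lemma insertionZ l (x : chn n.+1) :
  clift (fun a y => \sum_j tcons (a * u j) (G j y)) (l *: x) =
  l *: clift (fun a y => \sum_j tcons (a * u j) (G j y)) x.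
Proof.
have FB := cliftB insertion_balanced.
move: x; apply: chains_consP => [x y|x y|a y].
- by rewrite scalerBr FB.
- by rewrite FB scalerBr.
rewrite scale_tcons !(cliftE insertion_balanced) scaler_sumr.
by apply: eq_bigr => j _; rewrite scale_tcons lscaleAl.
Qed.
End Insertion.

Lemma rscale_v j (l : k) : rscale (v j) l = lscale (sigma (d j) l) (v j).
Proof. by rewrite (lscale_homog _ (vh j)) sigma_sigma addbb. Qed.

Lemma tcons_vZ n j l (y : chn n) : tcons (v j) (l *: y) = sigma (d j) l *: tcons (v j) y.
Proof. by rewrite -tcons_rscale rscale_v scale_tcons. Qed.

Lemma tlmul_vZ n j l (y : chn n) : tlmul (v j) (l *: y) = sigma (d j) l *: tlmul (v j) y.
Proof. by rewrite -tlmul_rscale rscale_v scale_tlmul. Qed.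

Lemma htp_linear n : zmod_morphism (@htp n) /\ (forall l x, @htp n (l *: x) = l *: htp x).
Proof.
elim: n => [|n [IHB IHZ]].
  have D : {morph (fun a => \sum_j tcons (a * u j) (chain0 (v j)) : chn 1) : x y / x + y}.
    by move=> a b; rewrite -big_split; apply: eq_bigr => j _; rewrite mulrDl tconsDl.
  have HB : zmod_morphism (@htp 0) := tlift0B D.
  split=> // l; apply: chain0_ext => [x y|x y|a].
  - by rewrite scalerBr HB.
  - by rewrite HB scalerBr.
  rewrite scale_chain0 /htp !tlift0E // scaler_sumr.
  by apply: eq_bigr => j _; rewrite scale_tcons lscaleAl.
have GB j : zmod_morphism (fun y => tcons (v j) y - htp (tlmul (v j) y) : chn n.+1).
  by move=> x y; rewrite tconsB tlmulB IHB opprD addrACA -opprD.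
have GZ j l (y : chn n) : tcons (v j) (l *: y) - htp (tlmul (v j) (l *: y)) =
    sigma (d j) l *: (tcons (v j) y - htp (tlmul (v j) y)).
  by rewrite tcons_vZ tlmul_vZ IHZ scalerBr.
split; first exact/cliftB/insertion_balanced.
exact: insertionZ.
Qed.

Lemma htpB n : zmod_morphism (@htp n). Proof. exact: (htp_linear n).1. Qed.

Lemma htp_chain0 a : htp (chain0 a) = \sum_j tcons (a * u j) (chain0 (v j)).
Proof.
rewrite /htp tlift0E // => x y; rewrite -big_split; apply: eq_bigr => j _.
by rewrite mulrDl tconsDl.
Qed.

Lemma htp_cons n a (y : chn n) :
  htp (tcons a y) = \sum_j tcons (a * u j) (tcons (v j) y - htp (tlmul (v j) y)).
Proof.
have GB j : zmod_morphism (fun y => tcons (v j) y - htp (tlmul (v j) y) : chn n.+1).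
  by move=> x z; rewrite tconsB tlmulB htpB opprD addrACA -opprD.
have GZ j l (x : chn n) : tcons (v j) (l *: x) - htp (tlmul (v j) (l *: x)) =
    sigma (d j) l *: (tcons (v j) x - htp (tlmul (v j) x)).
  by rewrite tcons_vZ tlmul_vZ (htp_linear n).2 scalerBr.
exact: (cliftE (insertion_balanced GB GZ)).
Qed.

Lemma tconj_linear m n : zmod_morphism (@tconj m n) /\
  (forall l x, @tconj m n (l *: x) = l *: tconj m x).
Proof.
elim: n => [|n [IHB IHZ]].
  have D : {morph (fun a => chain0 (a * u m) : chn 0) : x y / x + y}.
    by move=> a b; rewrite mulrDl raddfD.
  have HB : zmod_morphism (@tconj m 0) := tlift0B D.
  split=> // l; apply: chain0_ext => [x y|x y|a].
  - by rewrite scalerBr HB.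
  - by rewrite HB scalerBr.
  by rewrite scale_chain0 /tconj !tlift0E // scale_chain0 lscaleAl.
have GB j : zmod_morphism (fun y => tconj m (tlmul (v j) y) : chn n).
  exact: zmod_morphism_comp (tlmulB _) IHB.
have GZ j l (y : chn n) : tconj m (tlmul (v j) (l *: y)) =
    sigma (d j) l *: tconj m (tlmul (v j) y).
  by rewrite tlmul_vZ IHZ.
split; first exact/cliftB/insertion_balanced.
exact: insertionZ.
Qed.

Lemma tconjB m n : zmod_morphism (@tconj m n). Proof. exact: (tconj_linear m n).1. Qed.

Lemma tconj_chain0 m a : tconj m (chain0 a) = chain0 (a * u m).
Proof. by rewrite /tconj tlift0E // => x y; rewrite mulrDl raddfD. Qed.

Lemma tconj_cons m n a (y : chn n) :
  tconj m (tcons a y) = \sum_j tcons (a * u j) (tconj m (tlmul (v j) y)).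
Proof.
have GB j : zmod_morphism (fun y => tconj m (tlmul (v j) y) : chn n).
  exact: zmod_morphism_comp (tlmulB _) (@tconjB m n).
have GZ j l (x : chn n) : tconj m (tlmul (v j) (l *: x)) =
    sigma (d j) l *: tconj m (tlmul (v j) x).
  by rewrite tlmul_vZ (tconj_linear m n).2.
exact: (cliftE (insertion_balanced GB GZ)).
Qed.

Lemma tconj_lmul m n a (x : chn n) : tconj m (tlmul a x) = tlmul a (tconj m x).
Proof.
case: n x => [|n]; [apply: chain0_ext|apply: chains_consP].
1,4: exact: zmod_morphism_comp (tlmulB _) (@tconjB m _).
1,3: exact: zmod_morphism_comp (@tconjB m _) (tlmulB _).
  by move=> b; rewrite tlmul_chain0 !tconj_chain0 tlmul_chain0 mulrA.
move=> b y; rewrite tlmul_cons !tconj_cons raddf_sum; apply: eq_bigr => j _ /=.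
by rewrite tlmul_cons mulrA.
Qed.

(** The insertion touches a_0 only from the right. Hence v_j can be pulled out of h(v_j y) and
    multiplied by u_j, which is how the hypothesis that the u_j v_j add up to 1 enters in
    [sum_insert]. *)
Lemma htp_lmul n a (x : chn n) : htp (tlmul a x) = tlmul a (htp x).
Proof.
case: n x => [|n]; [apply: chain0_ext|apply: chains_consP].
1,4: exact: zmod_morphism_comp (tlmulB _) (@htpB _).
1,3: exact: zmod_morphism_comp (@htpB _) (tlmulB _).
  move=> b; rewrite tlmul_chain0 !htp_chain0 raddf_sum; apply: eq_bigr => j _ /=.
  by rewrite tlmul_cons mulrA.
move=> b y; rewrite tlmul_cons !htp_cons raddf_sum; apply: eq_bigr => j _ /=.
by rewrite tlmul_cons mulrA.
Qed.

(** Each inserted u_j (x) v_j is even, its two factors having the same parity. *)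
Lemma htp_csigma n b (x : chn n) : htp (csigma b x) = csigma b (htp x).
Proof.
elim: n x => [|n IH]; [apply: chain0_ext|apply: chains_consP].
1,4: exact: zmod_morphism_comp (csigmaB _) (@htpB _).
1,3: exact: zmod_morphism_comp (@htpB _) (csigmaB _).
  move=> a; rewrite csigma_chain0 !htp_chain0 raddf_sum; apply: eq_bigr => j _ /=.
  rewrite csigma_cons csigma_chain0 sigmaM (sigma_homog _ (uh j)) (sigma_homog _ (vh j)).
  by case: (_ && _); rewrite // mulrN tconsNl raddfN tconsNr opprK.
move=> a y; rewrite csigma_cons !htp_cons raddf_sum; apply: eq_bigr => j _ /=.
rewrite csigma_cons csigmaB csigma_cons -IH csigma_lmul sigmaM.
rewrite (sigma_homog _ (uh j)) (sigma_homog _ (vh j)).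
have lN (x : chn n) : tlmul (- v j) x = - tlmul (v j) x.
  by rewrite -[- v j](lscaleN1 (k := k)) -scale_tlmul scaleN1r.
have hN (x : chn n) : htp (- x) = - htp x.
  by rewrite -[- x]scaleN1r (htp_linear n).2 scaleN1r.
by case: (_ && _); rewrite // lN hN mulrN !tconsNl -opprD tconsNr opprK.
Qed.

Lemma bdiff'_htp0 (x : chn 0) : bdiff' (htp x) = x.
Proof.
move: x; apply: chain0_ext => [||a].
- exact: zmod_morphism_comp (@htpB _) (@bdiff'B _).
- by [].
rewrite htp_chain0 raddf_sum /=.
under eq_bigr do rewrite bdiff'_cons0 tlmul_chain0 -mulrA.
by rewrite -raddf_sum -mulr_sumr uv1 mulr1.
Qed.

Lemma bdiff'_lmul n a (x : chn n.+1) : bdiff' (tlmul a x) = tlmul a (bdiff' x).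
Proof.
move: x; apply: chains_consP => [||b y].
- exact: zmod_morphism_comp (tlmulB _) (@bdiff'B _).
- exact: zmod_morphism_comp (@bdiff'B _) (tlmulB _).
case: n y => [|n] y; rewrite tlmul_cons ?bdiff'_cons0 ?bdiff'_cons ?tlmulM //.
by rewrite raddfB /= tlmulM tlmul_cons.
Qed.

Lemma sum_insert n a (y : chn n) :
  \sum_j tlmul (a * u j) (tcons (v j) y - htp (tlmul (v j) y)) =
  tcons a y - tlmul a (htp y).
Proof.
under eq_bigr do rewrite raddfB /= tlmul_cons -htp_lmul tlmulM -mulrA.
rewrite sumrB -tcons_suml -mulr_sumr uv1 mulr1; congr (_ - _).
under eq_bigr do rewrite htp_lmul.
by rewrite -tlmul_suml -mulr_sumr uv1 mulr1.
Qed.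

Lemma bdiff'_htp n (x : chn n.+1) : bdiff' (htp x) + htp (bdiff' x) = x.
Proof.
elim: n x => [|n IH]; apply: chains_consP => [||a y].
1,4: apply: zmod_morphismD.
1,3: exact: zmod_morphism_comp (@htpB _) (@bdiff'B _).
1,2: exact: zmod_morphism_comp (@bdiff'B _) (@htpB _).
1,3: by [].
  rewrite htp_cons raddf_sum /= bdiff'_cons0 htp_lmul.
  under eq_bigr => j _.
    rewrite bdiff'_cons [bdiff' (_ - _)]raddfB /= bdiff'_cons0 bdiff'_htp0 subrr raddf0 subr0.
    over.
  by rewrite sum_insert subrK.
(* Here b'(v_j (x) y) = v_j y - v_j (x) b'y, and by induction b'h(v_j y) = v_j y - h(v_j b'y); the
   terms v_j y cancel. *)
have step j : bdiff' (tcons (v j) y - htp (tlmul (v j) y)) =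
    - (tcons (v j) (bdiff' y) - htp (tlmul (v j) (bdiff' y))).
  rewrite bdiff'B bdiff'_cons -bdiff'_lmul -{1}(IH (tlmul (v j) y)).
  by rewrite addrAC [_ + htp _]addrC addrK opprB.
rewrite htp_cons raddf_sum /= [bdiff' (tcons a y)]bdiff'_cons htpB htp_lmul htp_cons.
under eq_bigr do rewrite bdiff'_cons step tconsNr opprK.
rewrite big_split /= sum_insert addrACA.
by rewrite subrK subrr addr0.
Qed.

(** Splits off the last summand of the alternating sum, where the insertion comes after c. It is the
    only one in which the last face meets an inserted v_m instead of c. *)
Lemma htp_snoc n c (x : chn n) : htp (tsnoc c x) =
  tsnoc c (htp x) + (-1) ^+ n.+1 *: \sum_m tsnoc (v m) (tconj m (tsnoc c x)).
Proof.
have gB (n' : nat) : zmod_morphism (fun x : chn n' => \sum_m tsnoc (v m) (tconj m (tsnoc c x))).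
  apply: zmod_morphism_sum => m; apply: zmod_morphism_comp (tsnocB _).
  exact: zmod_morphism_comp (tsnocB _) (@tconjB m _).
elim: n x => [|n IH]; [apply: chain0_ext|apply: chains_consP].
1,4: exact: zmod_morphism_comp (tsnocB _) (@htpB _).
1,3: apply: zmod_morphismD; first exact: zmod_morphism_comp (@htpB _) (tsnocB _).
1,2: by move=> x y; rewrite gB scalerBr.
  move=> a; rewrite tsnoc_chain0 htp_cons htp_chain0 raddf_sum /= expr1 scaleN1r.
  under [X in _ - X]eq_bigr => m _.
    rewrite tconj_cons raddf_sum /=.
    under eq_bigr do rewrite tlmul_chain0 tconj_chain0 tsnoc_cons tsnoc_chain0.
    over.
  rewrite exchange_big -sumrB; apply: eq_bigr => j _ /=.
  rewrite tsnoc_cons tsnoc_chain0 raddfB /= tlmul_chain0 htp_chain0 raddf_sum /=.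
  by [].
move=> a y; rewrite tsnoc_cons !htp_cons raddf_sum /=.
under [X in _ *: X]eq_bigr => m _.
  rewrite tconj_cons raddf_sum /=.
  under eq_bigr do rewrite tsnoc_cons.
  over.
rewrite exchange_big scaler_sumr -big_split; apply: eq_bigr => j _ /=.
rewrite tsnoc_cons -raddf_sum exprS mulN1r scaleNr -raddfZsign -raddfB /=; congr (tcons _ _).
rewrite tlmul_snoc IH raddfB /= tsnoc_cons opprD addrA; congr (_ - _).
Qed.

(** Up to signs, the sum of v_m a_0 u_j (x) v_j a_1 u_l (x) ... (x) v_r a_n u_m over all indices:
    the last face has carried the final v_m round to the front, and every factor now stands between
    a v and a u. *)
Definition conj_sum n (x : chn n) : chn n := \sum_m tlmul (v m) (csigma (d m) (tconj m x)).

Lemma conj_sumB n : zmod_morphism (@conj_sum n).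
Proof.
apply: zmod_morphism_sum => m; apply: zmod_morphism_comp (tlmulB _).
exact: zmod_morphism_comp (@tconjB m _) (csigmaB _).
Qed.

Lemma face_max_htp n (x : chn n.+1) :
  face n.+2 (htp x) = htp (face n.+1 x) + (-1) ^+ n.+1 *: conj_sum x.
Proof.
move: x; apply: chains_snocP.
- exact: zmod_morphism_comp (@htpB _) (@faceB _ _ _ _).
- apply: zmod_morphismD; first exact: zmod_morphism_comp (@faceB _ _ _ _) (@htpB _).
  by move=> x y; rewrite conj_sumB scalerBr.
move=> e c x hc; rewrite htp_snoc [face _ (_ + _)]raddfD /= linearZ /= raddf_sum /=.
rewrite !(face_max_snoc _ hc) -htp_csigma htp_lmul; congr (_ + _ *: _).
by apply: eq_bigr => m _; rewrite (face_max_snoc _ (vh m)).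
Qed.

Lemma bdiff_htp0 (x : chn 0) : bdiff (htp x) = x - conj_sum x.
Proof.
rewrite bdiffE bdiff'_htp0 expr1 scaleN1r; congr (_ - _).
move: x; apply: chain0_ext => [||a].
- exact: zmod_morphism_comp (@htpB _) (@faceB _ _ _ _).
- exact: conj_sumB.
rewrite htp_chain0 raddf_sum; apply: eq_bigr => m _ /=.
by rewrite -tsnoc_chain0 (face_max_snoc _ (vh m)) tconj_chain0.
Qed.

(** The b' parts add up to x. Of the last faces, h d_(n+1) occurs with the opposite signs (-1)^(n+2)
    and (-1)^(n+1), and [conj_sum] with their product -1. *)
Lemma bdiff_htp n (x : chn n.+1) : bdiff (htp x) + htp (bdiff x) = x - conj_sum x.
Proof.
have hD y z : htp (y + z) = htp y + htp z :> chn n.+1.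
  by apply/eqP; rewrite -subr_eq -htpB addrK.
rewrite !bdiffE face_max_htp hD (htp_linear n).2 addrACA bdiff'_htp; congr (_ + _).
rewrite scalerDr scalerA exprS mulN1r mulNr -expr2 sqrr_sign scaleN1r scaleNr.
by rewrite addrAC addNr add0r.
Qed.

End Homotopy.

Lemma zmod_morphism_sign (k : pzRingType) (U V : lmodType k) (f : U -> V) m x :
  zmod_morphism f -> f ((-1) ^+ m *: x) = (-1) ^+ m *: f x.
Proof.
move=> fB; pose F : {additive U -> V} := HB.pack f (GRing.isZmodMorphism.Build _ _ f fB).
exact: (raddfZsign F).
Qed.

(** * Compatibility of multiplicative semilinear maps with faces and rotation *)

Section MultiplicativeChainMap.
Variables (k : superComRingType) (R R' : superAlgType k).
Variables (theta : k -> k) (f : R -> R').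
Hypothesis fP : semialgebraic theta f.
Hypothesis fM : {morph f : x y / x * y}.
Hypothesis fsigma : forall b, {morph f : x / sigma b x >-> sigma b x}.

Lemma tmap_face n i (x : chains R n.+1) : (i <= n)%N ->
  tmap f (face i x) = face i (tmap f x).
Proof.
elim: n i x => [|n IH] i x lin; move: x; apply: chains_consP.
1,4: exact: zmod_morphism_comp (@faceB _ _ _ _) (@tmapB _ _ _ _ _ fP _).
1,3: exact: zmod_morphism_comp (@tmapB _ _ _ _ _ fP _) (@faceB _ _ _ _).
  case: i lin => // _ a y.
  by rewrite (tmap_cons fP) !face0_cons (tmap_lmul _ _ fP fM).
case: i lin => [|i] lin a y.
  by rewrite (tmap_cons fP) !face0_cons (tmap_lmul _ _ fP fM).
by rewrite (tmap_cons fP) !faceS_cons // (tmap_cons fP) IH.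
Qed.

Lemma tmap_csigma n b (x : chains R n) : tmap f (csigma b x) = csigma b (tmap f x).
Proof.
elim: n x => [|n IH]; [apply: chain0_ext|apply: chains_consP].
1,4: exact: zmod_morphism_comp (@csigmaB _ _ _ _) (@tmapB _ _ _ _ _ fP _).
1,3: exact: zmod_morphism_comp (@tmapB _ _ _ _ _ fP _) (@csigmaB _ _ _ _).
  by move=> a; rewrite csigma_chain0 !(tmap_chain0 fP) csigma_chain0 fsigma.
by move=> a y; rewrite csigma_cons !(tmap_cons fP) csigma_cons fsigma IH.
Qed.

Lemma tmap_cyct n (x : chains R n) : (forall e a, homog e a -> homog e (f a)) ->
  tmap f (cyct x) = cyct (tmap f x).
Proof.
move=> fh; case: n x => [|n] x; first by rewrite !cyct_chain0.
move: x; apply: chains_snocP.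
- exact: zmod_morphism_comp (@cyctB _ _ _) (@tmapB _ _ _ _ _ fP _).
- exact: zmod_morphism_comp (@tmapB _ _ _ _ _ fP _) (@cyctB _ _ _).
move=> e c x hc; rewrite (cyct_snoc _ hc) (tmap_snoc fP) (cyct_snoc _ (fh _ _ hc)).
by rewrite (zmod_morphism_sign _ _ (@tmapB _ _ _ _ _ fP _)) (tmap_cons fP) tmap_csigma.
Qed.
End MultiplicativeChainMap.

(** * The supertrace on chains *)

Section Supertrace.
Variables (k : superComRingType) (A : superAlgType k) (p q : nat).
Local Notation M := (supermx p q A : superAlgType k).
Local Notation par := (@mxpar p q).
Local Notation idx := 'I_(p + q).
Implicit Types (X Y : M) (al be ga : idx).

Definition entry X al be : A := (X : 'M[A]_(p + q)) al be.

Lemma entryD X Y al be : entry (X + Y) al be = entry X al be + entry Y al be.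
Proof. by rewrite /entry mxE. Qed.

Lemma entryM X Y al be : entry (X * Y) al be = \sum_ga entry X al ga * entry Y ga be.
Proof. by rewrite /entry mxE. Qed.

Lemma twistE b (l : k) : twist A b l = lscale (sigma b l) 1.
Proof.
rewrite -(hcomp_sum l) twistD [sigma b _]raddfD lscaleDl /=.
congr (_ + _); rewrite (twist_homog _ b (homog_hcomp _ _)) (sigma_homog _ (homog_hcomp _ _)).
  by rewrite mul1r.
by case: b; rewrite ?mul1r //= mulN1r lscaleNl.
Qed.

Lemma entry_lscale l X al be : entry (lscale l X) al be = lscale (sigma (par al) l) (entry X al be).
Proof. by rewrite /entry mxlscaleE twistE -lscaleAl mul1r. Qed.

Lemma entry_rscale X l al be : entry (rscale X l) al be = rscale (entry X al be) (sigma (par be) l).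
Proof. by rewrite /entry mxrscaleE twistE -rscale_mulr. Qed.

Lemma entry_hcomp e X al be :
  entry (hcomp e X) al be = hcomp (e (+) (par al (+) par be)) (entry X al be).
Proof. by rewrite /entry mxE. Qed.

Lemma entry_homog e X al be : homog e X -> homog (e (+) (par al (+) par be)) (entry X al be).
Proof. by move/mx_homogP. Qed.

Lemma entryN X al be : entry (- X) al be = - entry X al be.
Proof. by rewrite /entry mxE. Qed.

Lemma entry_sigma b X al be :
  entry (sigma b X) al be = (-1) ^+ (b && (par al (+) par be)) * sigma b (entry X al be).
Proof.
case: b; rewrite /sigma /= ?mul1r //.
rewrite entryD entryN !entry_hcomp; case: (par al (+) par be) => /=.
  by rewrite mulN1r opprB.
by rewrite mul1r.
Qed.

(* sum X_0[al,i_1] (x) X_1[i_1,i_2] (x) ... (x) X_n[i_n,be] *)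
Fixpoint ctr n al be : chains M n -> chains A n :=
  match n with
  | 0 => tlift0 (fun X : M => chain0 (entry X al be))
  | n.+1 => clift (fun (X : M) y => \sum_ga tcons (entry X al ga) (@ctr n ga be y))
  end.
Arguments ctr : simpl never.

Lemma ctr_chain0 al be X : ctr al be (chain0 X) = chain0 (entry X al be).
Proof. by rewrite /ctr tlift0E // => Y Z; rewrite entryD raddfD. Qed.

(** On an entry, k acts from the left through the parity of the row and from the right through that
    of the column. At an inner index the right twist of one factor meets the equal left twist of the
    next, which makes the recursion well defined; only the twist at [al] survives. Both claims are
    proved together because the balance for n + 1 needs the semilinearity for n. *)
Lemma ctr_semilinear n al be : zmod_morphism (@ctr n al be) /\
  forall l x, @ctr n al be (l *: x) = sigma (par al) l *: @ctr n al be x.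
Proof.
elim: n al be => [|n IH] al be.
  have HB : zmod_morphism (@ctr 0 al be).
    by apply: tlift0B => Y Z; rewrite entryD raddfD.
  split=> // l; apply: chain0_ext => [x y|x y|X].
  - by rewrite scalerBr HB.
  - by rewrite HB scalerBr.
  by rewrite scale_chain0 !ctr_chain0 scale_chain0 entry_lscale.
have FP : balanced (fun (X : M) (y : chains M n) =>
    \sum_ga tcons (entry X al ga) (ctr ga be y)).
  split=> [y X Y|X|X l y].
  - by rewrite -big_split; apply: eq_bigr => ga _; rewrite entryD tconsDl.
  - by apply: zmod_morphism_sum => ga; apply: zmod_morphism_comp (IH _ _).1 (tconsB _).
  by apply: eq_bigr => ga _; rewrite entry_rscale (IH _ _).2 tcons_rscale.
have HB : zmod_morphism (@ctr n.+1 al be) := cliftB FP.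
split=> // l; apply: chains_consP => [x y|x y|X y].
- by rewrite scalerBr HB.
- by rewrite HB scalerBr.
rewrite scale_tcons -![ctr _ _ _]/(clift _ _) !(cliftE FP) scaler_sumr.
by apply: eq_bigr => ga _; rewrite entry_lscale scale_tcons.
Qed.

Lemma ctrB n al be : zmod_morphism (@ctr n al be).
Proof. exact: (ctr_semilinear n al be).1. Qed.

HB.instance Definition _ n al be :=
  GRing.isZmodMorphism.Build _ _ (@ctr n al be) (@ctrB n al be).

Lemma ctrZ n al be l (x : chains M n) : ctr al be (l *: x) = sigma (par al) l *: ctr al be x.
Proof. exact: (ctr_semilinear n al be).2. Qed.

Lemma ctr_cons n al be X (y : chains M n) :
  ctr al be (tcons X y) = \sum_ga tcons (entry X al ga) (ctr ga be y).
Proof.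
apply: (@cliftE k M n _ (fun (X : M) y => \sum_ga tcons (entry X al ga) (ctr ga be y))).
split=> [z Y Z|Y|Y l z].
- by rewrite -big_split; apply: eq_bigr => ga _; rewrite entryD tconsDl.
- by apply: zmod_morphism_sum => ga; apply: zmod_morphism_comp (ctrB _ _) (tconsB _).
by apply: eq_bigr => ga _; rewrite entry_rscale ctrZ tcons_rscale.
Qed.

Lemma ctr_lmul n al be X (y : chains M n) :
  ctr al be (tlmul X y) = \sum_ga tlmul (entry X al ga) (ctr ga be y).
Proof.
case: n y => [|n]; [apply: chain0_ext|apply: chains_consP].
1,4: exact: zmod_morphism_comp (@tlmulB _ _ _ _) (@ctrB _ _ _).
1,3: by apply: zmod_morphism_sum => ga; apply: zmod_morphism_comp (ctrB _ _) (@tlmulB _ _ _ _).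
  move=> Y; rewrite tlmul_chain0 ctr_chain0 entryM raddf_sum; apply: eq_bigr => ga _ /=.
  by rewrite ctr_chain0 tlmul_chain0.
move=> Y y; rewrite tlmul_cons ctr_cons.
under eq_bigr do rewrite entryM tcons_suml.
rewrite exchange_big; apply: eq_bigr => ga _ /=.
by rewrite ctr_cons raddf_sum; apply: eq_bigr => de _ /=; rewrite tlmul_cons.
Qed.

Lemma ctr_face n i al be (x : chains M n.+1) : (i <= n)%N ->
  ctr al be (face i x) = face i (ctr al be x).
Proof.
elim: n i al x => [|n IH] i al x lin; move: x; apply: chains_consP.
1,4: exact: zmod_morphism_comp (@faceB _ _ _ _) (@ctrB _ _ _).
1,3: exact: zmod_morphism_comp (@ctrB _ _ _) (@faceB _ _ _ _).
  case: i lin => // _ X y; rewrite face0_cons ctr_lmul ctr_cons raddf_sum.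
  by apply: eq_bigr => ga _ /=; rewrite face0_cons.
move=> X y; rewrite ctr_cons raddf_sum; case: i lin => [|i] lin.
  by rewrite face0_cons ctr_lmul; apply: eq_bigr => ga _ /=; rewrite face0_cons.
by rewrite faceS_cons // ctr_cons; apply: eq_bigr => ga _ /=; rewrite faceS_cons // IH.
Qed.

Lemma ctr_snoc n al be Y (x : chains M n) :
  ctr al be (tsnoc Y x) = \sum_ga tsnoc (entry Y ga be) (ctr al ga x).
Proof.
elim: n al x => [|n IH] al; [apply: chain0_ext|apply: chains_consP].
1,4: exact: zmod_morphism_comp (@tsnocB _ _ _ _) (@ctrB _ _ _).
1,3: by apply: zmod_morphism_sum => ga; apply: zmod_morphism_comp (ctrB _ _) (@tsnocB _ _ _ _).
  move=> X; rewrite tsnoc_chain0 ctr_cons; apply: eq_bigr => ga _.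
  by rewrite !ctr_chain0 tsnoc_chain0.
move=> X x; rewrite tsnoc_cons ctr_cons.
under eq_bigr do rewrite IH raddf_sum.
rewrite exchange_big; apply: eq_bigr => ga _ /=.
by rewrite ctr_cons raddf_sum; apply: eq_bigr => de _ /=; rewrite tsnoc_cons.
Qed.

Lemma tcons_sign (R : superAlgType k) n m a (y : chains R n) :
  tcons ((-1) ^+ m * a) y = (-1) ^+ m *: tcons a y.
Proof.
by rewrite -(signr_odd R m) -(signr_odd k m); case: (odd m);
  rewrite ?expr1 ?expr0 ?mulN1r ?scaleN1r ?tconsNl ?mul1r ?scale1r.
Qed.

(** The parity of an entry differs from that of its matrix by the parities of row and column. Along
    a path each inner index is counted twice, so only the two ends remain. *)
Lemma ctr_csigma n al be b (x : chains M n) :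
  ctr al be (csigma b x) = (-1) ^+ (b && (par al (+) par be)) *: csigma b (ctr al be x).
Proof.
elim: n al x => [|n IH] al; [apply: chain0_ext|apply: chains_consP].
1,4: exact: zmod_morphism_comp (@csigmaB _ _ _ _) (@ctrB _ _ _).
1,3: by move=> x y; rewrite ctrB csigmaB scalerBr.
  move=> X; rewrite csigma_chain0 !ctr_chain0 csigma_chain0 entry_sigma.
  by case: (b && _); rewrite ?expr1 ?expr0 ?mulN1r ?scaleN1r ?mul1r ?scale1r ?raddfN.
move=> X x; rewrite csigma_cons !ctr_cons raddf_sum scaler_sumr; apply: eq_bigr => ga _ /=.
rewrite entry_sigma tcons_sign IH raddfZsign csigma_cons scalerA -exprD /=; congr (_ *: _).
by apply: eq_sign; rewrite ?oddD !oddb; case: (b) (par al) (par be) (par ga) => [] [] [] [].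
Qed.

(* Applying sigma to all the factors yields the sign (-1)^(|X_0| + ... + |X_n|). *)
Definition stracen n (x : chains M n) : chains A n :=
  \sum_al (-1) ^+ (par al : nat) *: csigma (par al) (ctr al al x).

(** The twist that [ctr] leaves at [al] is undone by [csigma (par al)]. *)
Fact stracen_linear n : linear (@stracen n).
Proof.
move=> l x y; rewrite /stracen scaler_sumr -big_split; apply: eq_bigr => al _ /=.
by rewrite raddfD /= ctrZ raddfD /= csigmaZ sigma_sigma addbb scalerDr sign_scaleC.
Qed.
HB.instance Definition _ n :=
  GRing.isLinear.Build k _ _ _ (@stracen n) (@stracen_linear n).

Lemma stracenB n : zmod_morphism (@stracen n). Proof. exact: raddfB. Qed.

Lemma stracen_face_lt n i (x : chains M n.+1) : (i <= n)%N ->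
  stracen (face i x) = face i (stracen x).
Proof.
move=> lin; rewrite /stracen raddf_sum; apply: eq_bigr => al _ /=.
by rewrite linearZ /= ctr_face // face_csigma.
Qed.

Lemma stracen_cyct n (x : chains M n) : stracen (cyct x) = cyct (stracen x).
Proof.
case: n x => [|n] x; first by rewrite !cyct_chain0.
move: x; apply: chains_snocP.
- exact: zmod_morphism_comp (@cyctB _ _ _) (@stracenB _).
- exact: zmod_morphism_comp (@stracenB _) (@cyctB _ _ _).
move=> e Y x hY; rewrite (cyct_snoc _ hY) linearZ /= /stracen [RHS]raddf_sum scaler_sumr /=.
under eq_bigr do rewrite ctr_cons raddf_sum !scaler_sumr.
(* Closed paths are matched by moving their starting point: on the left they begin with the row [ga]
   of Y, on the right with its column [al]. *)
rewrite exchange_big; apply: eq_bigr => al _ /=.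
rewrite linearZ /= ctr_snoc !raddf_sum ?scaler_sumr; apply: eq_bigr => ga _ /=.
have hE := entry_homog ga al hY.
rewrite csigma_snoc (cyct_snoc _ (homog_sigma _ hE)) ctr_csigma !csigma_cons.
rewrite !(sigma_homogM _ hE) !tcons_sign (zmod_morphism_sign _ _ (csigmaB _))
  (zmod_morphism_sign _ _ (tconsB _)) !csigma_csigma !scalerA -!exprD.
(* The two automorphisms applied to x agree: on the right, the parity of the rotated entry of Y adds
   to that of the starting index. *)
have -> : par ga (+) e = e (+) (par ga (+) par al) (+) par al.
  by case: (e) (par al) (par ga) => [] [] [].
congr (_ *: _); apply: eq_sign; rewrite !oddD.
by case: (e) (par al) (par ga) (odd n.+1) => [] [] [] [].
Qed.

Lemma stracen_face n i (x : chains M n.+1) : (i <= n.+1)%N ->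
  stracen (face i x) = face i (stracen x).
Proof.
rewrite leq_eqVlt ltnS => /predU1P[->|]; last by move=> lin; rewrite stracen_face_lt.
by rewrite !face_max linearZ /= stracen_face_lt // stracen_cyct.
Qed.

Lemma stracen_bdiff n (x : chains M n.+1) : stracen (bdiff x) = bdiff (stracen x).
Proof.
rewrite /bdiff raddf_sum; apply: eq_bigr => i _ /=.
by rewrite linearZ /= stracen_face // -ltnS.
Qed.

Lemma stracen_bdiff' n (x : chains M n.+1) : stracen (bdiff' x) = bdiff' (stracen x).
Proof.
rewrite /bdiff' raddf_sum; apply: eq_bigr => i _ /=.
by rewrite linearZ /= stracen_face // ltnW.
Qed.

Lemma stracen_cycT n (x : chains M n) : stracen (cycT x) = cycT (stracen x).
Proof. by rewrite /cycT stracenB stracen_cyct. Qed.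

Lemma stracen_cycN n (x : chains M n) : stracen (cycN x) = cycN (stracen x).
Proof.
rewrite /cycN raddf_sum; apply: eq_bigr => i _ /=.
by elim: (nat_of_ord i) => //= m IH; rewrite stracen_cyct IH.
Qed.

Lemma crscale_chain0 (R : superAlgType k) (a : R) l :
  crscale (chain0 a : chains R 0) l = chain0 (rscale a l).
Proof.
rewrite /chain0 crscaleE; congr tpure; apply/ffunP => i.
have -> : ord_max = i :> 'I_1 by rewrite (ord1 i); apply: val_inj.
by rewrite upd_same !ffunE.
Qed.

Lemma crscale_snoc (R : superAlgType k) n c (x : chains R n) l :
  crscale (tsnoc c x) l = tsnoc (rscale c l) x.
Proof.
move: x; apply: chains_ext => [||t].
- exact: zmod_morphism_comp (@tsnocB _ _ _ _) (@crscaleB _ _ _ _).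
- exact: tsnocB.
rewrite !tsnoc_pure crscaleE; congr tpure; apply/ffunP => i.
case: (unliftP ord_max i) => [j|] ->; last by rewrite upd_same !snocT_max.
by rewrite upd_diff ?snocT_lift // eq_sym neq_lift.
Qed.

(** As the paths are closed, the right action arrives with the same twist [par al] as the left one,
    and [csigma] undoes it too. *)
Lemma stracen_crscale n (x : chains M n) l :
  stracen (crscale x l) = crscale (stracen x) l.
Proof.
have cD (m : nat) (I : finType) (F : I -> chains A m) :
    crscale (\sum_i F i) l = \sum_i crscale (F i) l.
  pose C : {additive chains A m -> chains A m} := HB.pack (fun z : chains A m => crscale z l)
    (GRing.isZmodMorphism.Build _ _ (fun z : chains A m => crscale z l) (crscaleB l)).
  exact: (raddf_sum C).
have cS m b (z : chains A m) : crscale ((-1) ^+ b *: z) l = (-1) ^+ b *: crscale z l.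
  exact: (zmod_morphism_sign _ _ (crscaleB l)).
case: n x => [|n]; [apply: chain0_ext|apply: chains_snocP].
1,4: exact: zmod_morphism_comp (@crscaleB _ _ _ _) (@stracenB _).
1,3: exact: zmod_morphism_comp (@stracenB _) (@crscaleB _ _ _ _).
  move=> X; rewrite crscale_chain0 cD; apply: eq_bigr => al _.
  rewrite cS !ctr_chain0 !csigma_chain0 crscale_chain0 entry_rscale sigma_rscale sigma_sigma.
  by rewrite addbb.
move=> e Y x _; rewrite crscale_snoc cD; apply: eq_bigr => al _.
rewrite cS !ctr_snoc; congr (_ *: _); rewrite !raddf_sum cD; apply: eq_bigr => ga _ /=.
by rewrite !csigma_snoc crscale_snoc entry_rscale sigma_rscale sigma_sigma addbb.
Qed.

(** A diagonal entry has the parity of the homogeneous matrix it comes from, so the factor (-1)^(1 +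
    |X|) of the second block is a minus sign together with [sigma]. *)
Lemma strE (X : M) : str X = \sum_al (-1) ^+ (par al : nat) * sigma (par al) (entry X al al).
Proof.
rewrite /str big_split_ord big_split /=; congr (_ + _).
  rewrite exchange_big /=; apply: eq_bigr => i _.
  rewrite /mxpar /= leqNgt ltn_ord mul1r -[in RHS](sum_hcomp (entry X _ _)).
  by apply: eq_bigr => e _; rewrite !mxE addbb addbF.
under eq_bigr do rewrite mulr_sumr.
rewrite exchange_big /=; apply: eq_bigr => i _.
rewrite /mxpar /= leq_addr mulN1r big_bool /= !mxE addbb !addbF /=.
by rewrite /sigma opprB expr1 expr2 !mulN1r opprK mul1r.
Qed.

Lemma stracen_chain0 (X : M) : stracen (chain0 X) = chain0 (str X).
Proof.
rewrite strE raddf_sum; apply: eq_bigr => al _ /=.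
by rewrite ctr_chain0 csigma_chain0; case: (par al); rewrite /= ?scaleN1r ?mulN1r ?raddfN ?scale1r ?mul1r.
Qed.

End Supertrace.

(** * The cyclic operator has order n + 1, so the rows are complexes *)

Section CyclicOrder.
Variables (k : superComRingType) (R : superAlgType k).

(** The index is shifted by m n instead of - m: n is -1 modulo n + 1, and truncated subtraction is
    avoided. *)
Lemma iter_rotT (T : Type) n m (a : {ffun 'I_n.+1 -> T}) (j : 'I_n.+1) :
  iter m (@rotT n T) a j = a (inord ((j + m * n) %% n.+1)).
Proof.
elim: m j => [|m IH] j; first by rewrite addn0 modn_small // inord_val.
have -> : iter m.+1 (@rotT n T) a j = iter m (@rotT n T) a (inord ((j + n) %% n.+1)).
  rewrite iterS ffunE -val_eqE /=.
  have [j0|j0] := eqVneq (j : nat) 0%N.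
    by rewrite j0 add0n modn_small //; congr (_ _); apply: val_inj; rewrite /= inordK.
  congr (_ (inord _)); rewrite -{2}(prednK (n := j)) ?lt0n // addSnnS modnDr modn_small //.
  exact: leq_ltn_trans (leq_pred _) _.
by rewrite IH inordK ?ltn_mod // modnDml -addnA mulSn.
Qed.

Lemma iter_rotT_id (T : Type) n (a : {ffun 'I_n.+1 -> T}) : iter n.+1 (@rotT n T) a = a.
Proof.
apply/ffunP => j; rewrite iter_rotT addnC mulnC modnMDl modn_small //.
by rewrite inord_val.
Qed.

Lemma psum_iter_rotT n m (e : {ffun 'I_n.+1 -> bool}) :
  psum (iter m (@rotT n bool) e) n.+1 = psum e n.+1.
Proof.
elim: m => // m <-; rewrite iterS psum_rotT // addnC.
by rewrite (psumS (iter m (@rotT n bool) e) ord_max).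
Qed.

(** Modulo 2, |a_n| (|a| - |a_n|) = |a_n| (1 + |a|). The total parity |a| is invariant under
    rotation, so the exponents of successive rotations can be added up. *)
Lemma odd_koszul n (e : {ffun 'I_n.+1 -> bool}) :
  odd (koszul e) = e ord_max && ~~ odd (psum e n.+1).
Proof.
rewrite /koszul -[X in (_ * X)%N]/(psum e n) oddM (psumS e ord_max) oddD !oddb.
by case: (e ord_max); rewrite // addbT negbK.
Qed.

Lemma cyct_homogs n e (t : {ffun 'I_n.+1 -> R}) : homogs e t ->
  cyct (tpure t) = (-1) ^+ (n + koszul e) *: tpure (rotT t).
Proof. by move=> ht; rewrite cyctE (hsumE (@cyct_multiadd k R n) ht). Qed.

Lemma iter_cyctB n m : zmod_morphism (iter m (@cyct k R n)).
Proof. by elim: m => [|m IH] x y //; rewrite !iterS IH cyctB. Qed.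

(* The Koszul signs of a full turn add up to |a|(1 + |a|), |a| the total parity. *)
Lemma iter_cyct n (x : chains R n) : iter n.+1 (@cyct k R n) x = x.
Proof.
move: x; apply: chains_ext => [||t]; [exact: iter_cyctB|by []|].
move: t; apply: multiadd_ext.
- exact: (multiadd_comp (@iter_cyctB n n.+1) (@tpure_multilin k R n).1).
- exact: (@tpure_multilin k R n).1.
move=> e t ht.
have H m : homogs (iter m (@rotT n bool) e) (iter m (@rotT n R) t) /\
    iter m (@cyct k R n) (tpure t) =
    (-1) ^+ (\sum_(i < m) (n + koszul (iter i (@rotT n bool) e))) *:
      tpure (iter m (@rotT n R) t).
  elim: m => [|m [hm IH]]; first by rewrite big_ord0 scale1r.
  split; first by rewrite !iterS; apply: rotT_homogs.
  rewrite iterS IH big_ord_recr /= (zmod_morphism_sign _ _ (@cyctB _ _ _)).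
  by rewrite (cyct_homogs hm) scalerA -exprD.
rewrite (H _).2 iter_rotT_id -[RHS]scale1r; congr (_ *: _).
rewrite -[RHS](expr0 (-1)); apply: eq_sign; rewrite big_split /= oddD.
(* The n + 1 factors (-1)^n multiply to 1, n (n + 1) being even. *)
rewrite sum_nat_const card_ord oddM /= andNb /=.
have -> : odd (\sum_(i < n.+1) koszul (iter i (@rotT n bool) e)) =
    odd ((\sum_(i < n.+1) iter i (@rotT n bool) e ord_max) * ~~ odd (psum e n.+1)).
  rewrite big_distrl /=; have -> := big_morph odd oddD (erefl : odd 0 = false).
  have -> := big_morph odd oddD (erefl : odd 0 = false).
  by apply: eq_bigr => i _; rewrite odd_koszul psum_iter_rotT oddM !oddb.
(* In a full turn each factor is last exactly once. *)
have -> : (\sum_(i < n.+1) iter i (@rotT n bool) e ord_max = psum e n.+1)%N.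
  rewrite /psum (reindex_inj rev_ord_inj) /=; apply: eq_bigr => i _.
  rewrite iter_rotT; congr (nat_of_bool (e (inord _))).
  have := ltn_ord i; rewrite ltnS => lin.
  have -> : (@ord_max n + (n.+1 - i.+1) * n = (n - i) * n.+1 + i)%N.
    by rewrite subSS mulnS -addnA [(_ * _ + i)%N]addnC addnA subnK.
  by rewrite modnMDl modn_small.
by rewrite oddM oddb andbN.
Qed.

Lemma cycN_cyct n (x : chains R n) : cycN (cyct x) = cyct (cycN x).
Proof.
by rewrite /cycN raddf_sum; apply: eq_bigr => i _ /=; rewrite -iterSr.
Qed.

Lemma cycN_cycT n (x : chains R n) : cycN (cycT x) = 0.
Proof.
rewrite /cycT raddfB /= {2}/cycN.
under [X in _ - X]eq_bigr do rewrite -iterSr.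
by rewrite big_ord_recr /= -iterS iter_cyct /cycN big_ord_recl /= addrC subrr.
Qed.

Lemma cycT_cycN n (x : chains R n) : cycT (cycN x) = 0.
Proof. by rewrite /cycT -cycN_cyct -raddfB /= -/(cycT x) cycN_cycT. Qed.

Lemma CC_hdiff_hdiff i j (x : chains R j) : CC_hdiff R i j (CC_hdiff R i.+1 j x) = 0.
Proof.
by rewrite /CC_hdiff /=; case: (odd i) => /=; rewrite ?cycN_cycT ?cycT_cycN.
Qed.
End CyclicOrder.

(** * Retracts of bicomplexes *)

Section DeformationRetract.
Variables (k : pzRingType) (X Y : bicomplex k) (F : bimorphism X Y) (G : bimorphism Y X).
Hypothesis FG : forall i j, cancel (G i j) (F i j).
Hypothesis square : forall i j x, vdiff X i j (hdiff X i j.+1 x) = hdiff X i j (vdiff X i.+1 j x).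
Hypothesis hdiff2 : forall i j x, hdiff X i j (hdiff X i.+1 j x) = 0.
Hypothesis retract0 : forall i (x : X i 0%N),
  exists y, vdiff X i 0 y = x - G i 0 (F i 0 x).
Hypothesis retractS : forall i j (x : X i j.+1), vdiff X i j x = 0 ->
  exists y, vdiff X i j.+1 y = x - G i j.+1 (F i j.+1 x).

Definition vcycle i j : X i j -> Prop :=
  match j with 0 => fun=> True | j.+1 => fun x => vdiff X i j x = 0 end.

(** A primitive y of x need not lie in the kernel of F, but y - G F y does, and it is still a
    primitive because F x = 0. *)
Lemma kernel_column_exact i j (x : X i j) : vcycle x -> F i j x = 0 ->
  exists2 y, vdiff X i j y = x & F i j.+1 y = 0.
Proof.
move=> vx Fx; have [y vy] : exists y, vdiff X i j y = x - G i j (F i j x).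
  by case: j x vx {Fx} => [|j] x vx; [exact: retract0 | exact: retractS vx].
rewrite Fx linear0 subr0 in vy.
exists (y - G i j.+1 (F i j.+1 y)); last by rewrite raddfB /= FG subrr.
by rewrite raddfB /= -bmap_vdiff -bmap_vdiff vy Fx linear0 subr0.
Qed.

Lemma kernel_cycle_boundary n (w : bfam X) : tot n w -> tdiff w = 0 ->
  (forall i j, F i j (w i j) = 0) -> exists2 y, tot n.+1 y & w = tdiff y.
Proof.
move=> wn w0 Fw.
have dE (y : bfam X) i j : tdiff y i j =
  (-1) ^+ i *: vdiff X i j (y i j.+1) + hdiff X i j (y i.+1 j) by [].
(* After m steps the equation holds in the columns i > n - m, and y is still zero in all the
   others. *)
have H m : (m <= n.+1)%N -> exists y : bfam X, [/\ tot n.+1 y,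
    forall i j, F i j (y i j) = 0, forall i j, (i + m <= n)%N -> y i j = 0 &
    forall i j, (n < i + m)%N -> tdiff y i j = w i j].
  elim: m => [_|m IH mn].
    (* Beyond column n the family w vanishes, being supported on i + j = n. *)
    exists 0; split=> //; first by move=> i j; apply: linear0.
    move=> i j; rewrite addn0 => ni; rewrite linear0 wn // neq_ltn.
    by rewrite (leq_trans ni (leq_addr _ _)) orbT.
  have [y [yn Fy y0 dy]] := IH (ltnW mn); pose i0 := (n - m)%N.
  have i0m : (i0 + m = n)%N by rewrite subnK.
  (* The defect in column n - m, which sits in row m; the new component of y has to supply it
     through the vertical differential. *)
  pose r := w i0 m - hdiff X i0 m (y i0.+1 m).
  have vr : vcycle r.
    have dy' j : tdiff y i0.+1 j = w i0.+1 j by apply: dy; rewrite addSn i0m.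
    rewrite /r; case: (m) => //= j; rewrite raddfB /= square.
    (* The horizontal differential is applied to the equation already solved in column i0 + 1. Its
       square is zero, so column i0 + 2 drops out. *)
    have hw : hdiff X i0 j (w i0.+1 j) =
        - ((-1) ^+ i0 *: hdiff X i0 j (vdiff X i0.+1 j (y i0.+1 j.+1))).
      by rewrite -dy' dE linearD linearZ /= hdiff2 addr0 exprS mulN1r scaleNr.
    have : (-1) ^+ i0 *: vdiff X i0 j (w i0 j.+1) + hdiff X i0 j (w i0.+1 j) = 0.
      exact: (congr1 (fun z : bfam X => z i0 j) w0).
    rewrite hw -scalerBr => /(congr1 ( *:%R ((-1) ^+ i0))).
    by rewrite scalerA -expr2 sqrr_sign scale1r scaler0.
  have Fr : F i0 m r = 0 by rewrite /r raddfB /= Fw bmap_hdiff Fy linear0 subr0.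
  have [c vc Fc] := kernel_column_exact vr Fr.
  (* y is changed in the single place (i0, m + 1). The cast transports the new component along the
     equality of indices, and (-1)^i0 cancels the sign of the vertical part of [tdiff]. *)
  pose y' : bfam X := fun i j => if (i, j) =P (i0, m.+1) is ReflectT e
    then ecast z (X z.1 z.2) (esym e) ((-1) ^+ i0 *: c) else y i j.
  have y'c : y' i0 m.+1 = (-1) ^+ i0 *: c.
    by rewrite /y'; case: eqP => // e; rewrite eq_axiomK.
  have y'y i j : (i, j) != (i0, m.+1) -> y' i j = y i j.
    by rewrite /y'; case: eqP.
  have y'i i j : i != i0 -> y' i j = y i j.
    by move=> ii; apply: y'y; rewrite xpair_eqE (negbTE ii).
  exists y'; split.
  - move=> i j ij; rewrite y'y ?yn //; apply: contraNneq ij => -[-> ->].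
    by rewrite addnS i0m.
  - move=> i j; have [[-> ->]|] := eqVneq (i, j) (i0, m.+1); last by move/y'y ->.
    by rewrite y'c linearZ /= Fc scaler0.
  - move=> i j ilt; rewrite y'i ?y0 ?(leq_trans _ ilt) ?leq_add2l //.
    by rewrite neq_ltn -(ltn_add2r m) i0m -addnS ilt.
  move=> i j; rewrite addnS ltnS leq_eqVlt => /predU1P[E|nlt]; last first.
    have i0i : (i0 < i)%N by rewrite -(ltn_add2r m) i0m.
    by rewrite -(dy i j nlt) !dE (y'i i) ?(y'i i.+1) // gtn_eqF // ltnW.
  have {i E} -> : i = i0 by apply/eqP; rewrite -(eqn_add2r m) -E i0m.
  rewrite dE [y' i0.+1 j]y'i ?gtn_eqF //.
  have [->|jm] := eqVneq j m; first by rewrite y'c linearZ /= scalerA -expr2 sqrr_sign scale1r vc subrK.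
  rewrite y'y ?xpair_eqE ?eqxx //= yn ?linear0 ?scaler0 ?add0r; last first.
    by rewrite addnS eqSS -i0m eqn_add2l.
  by rewrite yn ?linear0 ?wn // ?addSn ?eqSS -i0m eqn_add2l.
have [y [yn _ _ dy]] := H n.+1 (leqnn _).
exists y => //; apply: bfamP => i j; rewrite dy //.
by rewrite addnS ltnS leq_addl.
Qed.

(** The inverse is induced by G: F G = 1 holds on cycles already, and z - G F z is a cycle killed by
    F, hence a boundary. *)
Lemma retract_homology_bijective n : bijective (homology_map F n).
Proof.
exists (homology_map G n) => c.
  rewrite -(hreprK c) !homology_map_class; set z := hrepr c.
  apply/eqP; rewrite eq_sym -subr_eq0 -raddfB /= hclass_eq0.
  have /asboolP[wn w0] := valP (z - cycles_map G (cycles_map F z)).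
  apply/asboolP/(kernel_cycle_boundary wn w0) => i j.
  rewrite -[X in F i j X]/(cycle_val z i j - G i j (F i j (cycle_val z i j))).
  by rewrite raddfB /= FG subrr.
rewrite -(hreprK c) !homology_map_class; congr hclass; apply: val_inj.
by apply: bfamP => i j; apply: FG.
Qed.
End DeformationRetract.

(** * The corner inclusion *)

Section Corner.
Variables (k : superComRingType) (A : superAlgType k) (p q : nat) (o : 'I_(p + q)).
Local Notation M := (supermx p q A : superAlgType k).
Local Notation par := (@mxpar p q).
Local Notation idx := 'I_(p + q).
Implicit Types (X Y : M) (al be ga : idx).

Lemma entryP X Y : (forall al be, entry X al be = entry Y al be) -> X = Y.
Proof. by move=> XY; apply/matrixP => i j; apply: XY. Qed.

Definition single al be (a : A) : M :=
  \matrix_(i, j) (if (i == al) && (j == be) then a else 0).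

Lemma single_entry al be a i j :
  entry (single al be a) i j = if (i == al) && (j == be) then a else 0.
Proof. by rewrite /entry mxE. Qed.

Lemma single_homog e al be a : homog e a ->
  homog (e (+) (par al (+) par be)) (single al be a).
Proof.
move=> ha; apply/mx_homogP => i j; rewrite mxE.
case: ifP => [/andP[/eqP-> /eqP->]|_]; last exact: homog0.
by rewrite addbK.
Qed.

Lemma single_mull al be X i j :
  entry (single al be 1 * X) i j = if i == al then entry X be j else 0.
Proof.
rewrite entryM (bigD1 be) //= single_entry eqxx andbT big1 ?addr0 => [|ga gb].
  by case: eqP; rewrite ?mul1r ?mul0r.
by rewrite single_entry (negbTE gb) andbF mul0r.
Qed.

Lemma single_mulr al be X i j :
  entry (X * single al be 1) i j = if j == be then entry X i al else 0.
Proof.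
rewrite entryM (bigD1 al) //= single_entry eqxx /= big1 ?addr0 => [|ga gb].
  by case: eqP; rewrite ?mulr1 ?mulr0.
by rewrite single_entry (negbTE gb) mulr0.
Qed.

Definition cpar al : bool := par al (+) par o.
Definition cu al : M := single al o 1.
Definition cv al : M := single o al 1.

Lemma cu_homog al : homog (cpar al) (cu al).
Proof. exact: (single_homog al o homog1). Qed.

Lemma cv_homog al : homog (cpar al) (cv al).
Proof. by rewrite /cpar addbC; exact: (single_homog o al homog1). Qed.

Lemma sum_cu_cv : \sum_al cu al * cv al = 1.
Proof.
apply: entryP => i j.
have entry_sum (F : idx -> M) : entry (\sum_al F al) i j = \sum_al entry (F al) i j.
  by rewrite /entry summxE.
rewrite entry_sum (bigD1 i) //= single_mull eqxx single_entry eqxx /=.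
rewrite big1 ?addr0 => [|al ai]; last by rewrite single_mull eq_sym (negbTE ai).
by rewrite /entry mxE eq_sym; case: eqP.
Qed.

Lemma single_semialgebraic :
  semialgebraic (@sigma k (par o)) (single o o : A -> M).
Proof.
have s0 b (l : k) : lscale l (0 : A) = 0.
  by apply: (addIr (lscale l (0 : A))); rewrite -lscaleDr !add0r.
have r0 (l : k) : rscale (0 : A) l = 0 by rewrite rscale_mulr mul0r.
split=> [x y|l a|a l]; apply: entryP => i j.
- by rewrite entryD !single_entry; case: ifP; rewrite ?addr0.
- rewrite entry_lscale !single_entry; case: eqP => [->|_] /=; last by rewrite (s0 true).
  by rewrite sigma_sigma addbb; case: ifP; rewrite ?(s0 true).
rewrite entry_rscale !single_entry; case: eqP => _ /=; last by rewrite r0.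
by case: eqP => [->|_]; rewrite ?r0 // sigma_sigma addbb.
Qed.

Lemma singleM : {morph (single o o : A -> M) : x y / x * y}.
Proof.
move=> x y; apply: entryP => i j; rewrite entryM (bigD1 o) //= !single_entry eqxx andbT.
rewrite big1 ?addr0 => [|al ao]; last by rewrite !single_entry (negbTE ao) andbF mul0r.
by case: eqP; case: eqP; rewrite /= ?mul0r ?mulr0.
Qed.

Lemma single_sigma b : {morph (single o o : A -> M) : x / sigma b x >-> sigma b x}.
Proof.
move=> x; apply: entryP => i j; rewrite entry_sigma !single_entry.
case: eqP => [->|_] /=; last by rewrite raddf0 mulr0.
by case: eqP => [->|_]; rewrite ?raddf0 ?mulr0 // addbb andbF mul1r.
Qed.

Lemma single_parity e a : homog e a -> homog e (single o o a : M).
Proof. by move=> ha; rewrite -[e]addbF -(addbb (par o)); apply: single_homog. Qed.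

Definition corner n (x : chains A n) : chains M n := tmap (single o o : A -> M) x.

Lemma cornerB n : zmod_morphism (@corner n).
Proof. exact/tmapB/single_semialgebraic. Qed.

(* In the odd block k acts through its parity automorphism: sigma restores
   k-linearity, and the sign makes the supertrace a retraction. *)
Definition incl n (x : chains A n) : chains M n :=
  (-1) ^+ (par o : nat) *: corner (csigma (par o) x).

Fact incl_linear n : linear (@incl n).
Proof.
have iB : zmod_morphism (@incl n) by move=> x y; rewrite /incl csigmaB cornerB scalerBr.
pose I : {additive chains A n -> chains M n} := HB.pack (@incl n)
  (GRing.isZmodMorphism.Build _ _ (@incl n) iB).
move=> l x y; rewrite -[@incl n]/(I : _ -> _) raddfD; congr (_ + _).
rewrite /= /incl csigmaZ /corner (tmapZ single_semialgebraic) sigma_sigma addbb.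
exact: esym (sign_scaleC _ _ _).
Qed.
HB.instance Definition _ n :=
  GRing.isLinear.Build k _ _ _ (@incl n) (@incl_linear n).

Lemma incl_face_lt n i (x : chains A n.+1) : (i <= n)%N -> incl (face i x) = face i (incl x).
Proof.
move=> lin; rewrite /incl linearZ /= /corner.
by rewrite -(tmap_face single_semialgebraic singleM) // face_csigma.
Qed.

Lemma incl_cyct n (x : chains A n) : incl (cyct x) = cyct (incl x).
Proof.
rewrite /incl linearZ /= /corner.
rewrite -(tmap_cyct single_semialgebraic single_sigma _ single_parity).
rewrite /csigma (tmap_cyct (sigma_semialgebraic _ _) _ _) // => [b y|e a].
  by rewrite !sigma_sigma addbC.
exact: homog_sigma.
Qed.

Lemma incl_face n i (x : chains A n.+1) : (i <= n.+1)%N -> incl (face i x) = face i (incl x).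
Proof.
rewrite leq_eqVlt ltnS => /predU1P[->|]; last exact: incl_face_lt.
by rewrite !face_max linearZ /= incl_face_lt // incl_cyct.
Qed.

Lemma incl_bdiff n (x : chains A n.+1) : incl (bdiff x) = bdiff (incl x).
Proof.
rewrite /bdiff raddf_sum; apply: eq_bigr => i _ /=.
by rewrite linearZ /= incl_face // -ltnS.
Qed.

Lemma incl_bdiff' n (x : chains A n.+1) : incl (bdiff' x) = bdiff' (incl x).
Proof.
rewrite /bdiff' raddf_sum; apply: eq_bigr => i _ /=.
by rewrite linearZ /= incl_face // ltnW.
Qed.

Lemma incl_cycT n (x : chains A n) : incl (cycT x) = cycT (incl x).
Proof. by rewrite /cycT raddfB /= incl_cyct. Qed.

Lemma incl_cycN n (x : chains A n) : incl (cycN x) = cycN (incl x).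
Proof.
rewrite /cycN raddf_sum; apply: eq_bigr => i _ /=.
by elim: (nat_of_ord i) => //= m IH; rewrite incl_cyct IH.
Qed.

Lemma ctr_corner n al be (x : chains A n) :
  ctr al be (corner x) = if (al == o) && (be == o) then x else 0.
Proof.
elim: n al x => [|n IH] al; [apply: chain0_ext|apply: chains_consP].
1,4: exact: zmod_morphism_comp (@cornerB _) (@ctrB _ _ _ _ _ _ _).
1,3: by move=> x y; case: ifP; rewrite ?subr0.
  move=> a; rewrite /corner (tmap_chain0 single_semialgebraic) ctr_chain0 single_entry.
  by case: ifP => // _; rewrite raddf0.
move=> a y; rewrite /corner (tmap_cons single_semialgebraic) -[tmap _ y]/(corner y) ctr_cons.
rewrite (bigD1 o) //= big1 ?addr0 => [|ga gao].
  rewrite single_entry eqxx andbT IH eqxx /=.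
  by case: eqP => _ /=; [case: eqP; rewrite ?raddf0 | rewrite tcons0l].
by rewrite single_entry (negbTE gao) andbF tcons0l.
Qed.

(** Only the constant path at o meets nonzero entries. The sign and the automorphism of [incl] meet
    those of the supertrace and cancel. *)
Lemma stracen_incl n (x : chains A n) : stracen (incl x) = x.
Proof.
rewrite /incl linearZ /= /stracen (bigD1 o) //= big1 ?addr0 => [|al alo].
  rewrite ctr_corner eqxx csigma_csigma addbb scalerA -expr2 sqrr_sign scale1r.
  exact: csigma_false.
by rewrite ctr_corner (negbTE alo) raddf0 scaler0.
Qed.

Local Notation conj_sum := (@conj_sum k M _ cpar cu cv).
Local Notation tconj := (@tconj k M _ cu cv).

(** E_oi X E_lo = X[i,l] E_oo: conjugation by matrix units reads off the entries and places them in
    the corner. *)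
Lemma cv_tconj n j m (x : chains M n) :
  tlmul (cv j) (tconj m x) = corner (ctr j m x).
Proof.
elim: n j x => [|n IH] j; [apply: chain0_ext|apply: chains_consP].
1,4: by move=> x y; rewrite (tconjB cu_homog cv_homog) tlmulB.
1,3: exact: zmod_morphism_comp (@ctrB _ _ _ _ _ _ _) (@cornerB _).
  move=> X; rewrite tconj_chain0 tlmul_chain0 ctr_chain0 /corner.
  rewrite (tmap_chain0 single_semialgebraic); congr chain0; apply: entryP => al be.
  by rewrite single_mull single_mulr single_entry; case: eqP.
have cD (F : idx -> chains A n.+1) : corner (\sum_i F i) = \sum_i corner (F i).
  pose C : {additive chains A n.+1 -> chains M n.+1} := HB.pack (@corner n.+1)
    (GRing.isZmodMorphism.Build _ _ (@corner n.+1) (@cornerB n.+1)).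
  exact: (raddf_sum C).
move=> X y; rewrite (tconj_cons cu_homog cv_homog) raddf_sum ctr_cons cD.
apply: eq_bigr => i _ /=; rewrite tlmul_cons (tconj_lmul cu_homog cv_homog) IH.
rewrite /corner (tmap_cons single_semialgebraic); congr (tcons _ _).
apply: entryP => al be; rewrite single_mull single_mulr single_entry; by case: eqP.
Qed.

(** The signs of supertrace and inclusion multiply to (-1)^(|m| + |o|). On the other side this sign
    arises when [csigma] is moved across v_m, whose parity is |m| + |o|. *)
Lemma conj_sum_incl n (x : chains M n) : conj_sum x = incl (stracen x).
Proof.
rewrite /stracen raddf_sum; apply: eq_bigr => m _ /=.
rewrite linearZ /= /incl csigma_csigma scalerA -exprD.
have -> : tlmul (cv m) (csigma (cpar m) (tconj m x)) =
    (-1) ^+ (cpar m : nat) *: csigma (cpar m) (tlmul (cv m) (tconj m x)).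
  rewrite csigma_lmul (sigma_homog _ (cv_homog m)) andbb.
  by case: (cpar m); rewrite ?expr0 ?scale1r // expr1 scaleN1r -[- cv m](lscaleN1 (k := k))
    -scale_tlmul scaleN1r opprK.
rewrite cv_tconj /corner -(tmap_csigma single_semialgebraic single_sigma) [par o (+) _]addbC.
have -> : (-1) ^+ (par m + par o) = (-1) ^+ (cpar m : nat) :> k by apply: eq_sign; rewrite oddD !oddb.
by [].
Qed.

Lemma incl_stracen_bdiff0 (x : chains M 0) :
  exists y, bdiff y = x - incl (stracen x).
Proof.
exists (htp cu cv x); rewrite -conj_sum_incl.
exact: (bdiff_htp0 cu_homog cv_homog sum_cu_cv).
Qed.

Lemma incl_stracen_bdiff n (x : chains M n.+1) : bdiff x = 0 ->
  exists y, bdiff y = x - incl (stracen x).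
Proof.
move=> x0; exists (htp cu cv x); rewrite -conj_sum_incl.
rewrite -(bdiff_htp cu_homog cv_homog sum_cu_cv) x0.
by rewrite -[0](subrr (0 : chains M n)) (htpB cu_homog cv_homog) subrr addr0.
Qed.

Lemma bdiff'_exact0 (x : chains M 0) : exists y, bdiff' y = x.
Proof. by exists (htp cu cv x); exact: (bdiff'_htp0 cu_homog cv_homog sum_cu_cv). Qed.

Lemma bdiff'_exact n (x : chains M n.+1) : bdiff' x = 0 -> exists y, bdiff' y = x.
Proof.
move=> x0; exists (htp cu cv x); rewrite -[RHS](bdiff'_htp cu_homog cv_homog sum_cu_cv) x0.
by rewrite -[0](subrr (0 : chains M n)) (htpB cu_homog cv_homog) subrr addr0.
Qed.

Fact incl_vdiff i j (x : CC A i j.+1) :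
  incl (vdiff (CC A) i j x) = vdiff (CC M) i j (incl (x : chains A j.+1)).
Proof.
rewrite /= /CC_vdiff; case: (odd i); [exact: incl_bdiff' | exact: incl_bdiff].
Qed.

Fact incl_hdiff i j (x : CC A i.+1 j) :
  incl (hdiff (CC A) i j x) = hdiff (CC M) i j (incl (x : chains A j)).
Proof.
rewrite /= /CC_hdiff; case: (odd i.+1); [exact: incl_cycT | exact: incl_cycN].
Qed.

Definition CC_incl : bimorphism (CC A) (CC M) :=
  @Bimorphism k (CC A) (CC M) (fun i j => @incl j : {linear chains A j -> chains M j})
    incl_vdiff incl_hdiff.
End Corner.

(** * The supertrace as a morphism of cyclic bicomplexes *)

Section CyclicSupertrace.
Variables (k : superComRingType) (A : superAlgType k) (p q : nat).
Local Notation M := (supermx p q A : superAlgType k).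

Fact stracen_vdiff i j (x : CC M i j.+1) :
  stracen (vdiff (CC M) i j x) = vdiff (CC A) i j (stracen (x : chains M j.+1)).
Proof.
rewrite /= /CC_vdiff; case: (odd i); [exact: stracen_bdiff' | exact: stracen_bdiff].
Qed.

Fact stracen_hdiff i j (x : CC M i.+1 j) :
  stracen (hdiff (CC M) i j x) = hdiff (CC A) i j (stracen (x : chains M j)).
Proof.
rewrite /= /CC_hdiff; case: (odd i.+1); [exact: stracen_cycT | exact: stracen_cycN].
Qed.

Definition Str : bimorphism (CC M) (CC A) :=
  @Bimorphism k (CC M) (CC A) (fun i j => @stracen k A p q j : {linear chains M j -> chains A j})
    stracen_vdiff stracen_hdiff.

Lemma Str_homology_bijective n : (p != 0)%N || (q != 0)%N ->
  bijective (homology_map Str n : HC M n -> HC A n).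
Proof.
(* Any index serves as corner, in the even block or in the odd one; p + q > 0 guarantees that there
   is one. *)
rewrite -!lt0n => pq; have o : 'I_(p + q).
  by apply: (@Ordinal _ 0); rewrite addn_gt0.
apply: (@retract_homology_bijective k (CC M) (CC A) Str (CC_incl A o)).
- by move=> i j x; apply: stracen_incl.
- by move=> i j x; apply: CC_square.
- by move=> i j x; apply: CC_hdiff_hdiff.
- move=> i x; rewrite /= /CC_vdiff; case: (odd i); last exact: incl_stracen_bdiff0.
  exact: (bdiff'_exact0 o).
move=> i j x; rewrite /= /CC_vdiff; case: (odd i); last exact: incl_stracen_bdiff.
(* In a b' column every cycle bounds, in particular x - G F x. *)
move=> x0; apply: (bdiff'_exact o); rewrite raddfB /= -incl_bdiff' -stracen_bdiff' x0.
by rewrite !raddf0 addr0.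
Qed.
End CyclicSupertrace.
#[local] Close Scope ring_scope.

Theorem theorem1 (k : superComRingType) (A : superAlgType k) (p q : nat)
    (pq_neq0 : (p != 0) || (q != 0)) :
  exists Str : bimorphism (CC (supermx p q A : superAlgType k)) (CC A),
    [/\ forall (i : nat) (M : supermx p q A), Str i 0 (chain0 M) = chain0 (str M),
        forall (i j : nat) (x : chains (supermx p q A : superAlgType k) j) (l : k),
          Str i j (crscale x l) = crscale (Str i j x : chains A j) l
      & forall n : nat,
          bijective (homology_map Str n : HC (supermx p q A : superAlgType k) n -> HC A n)].
Proof.
exists (Str A p q); split=> [i M|i j x l|n]; first exact: stracen_chain0.
  exact: stracen_crscale.
exact: Str_homology_bijective.
Qed.
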